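(* Fix $\alpha\in(0,1)$, and let $\mathcal{P}_\theta$ denote the law of ${\bf P}(\theta,\alpha)$ (that is, $PD(\theta,\alpha)$) on \[ \bar{\nabla}=\Big\{(p_1,p_2,\ldots):p_1\ge p_2\ge\cdots\ge 0,\ \sum_{i=1}^{\infty}p_i\le 1\Big\}. \] As $\theta\to\infty$, the family $\{\mathcal{P}_\theta:\theta>0\}$ satisfies a large deviation principle on $\bar\nabla$ with speed $\theta$ and rate function \[ I({\bf p})=\begin{cases}\log\dfrac{1}{1-\sum_{i=1}^{\infty}p_i}, & {\bf p}=(p_1,p_2,\ldots)\in\bar\nabla,\ \sum_{i=1}^{\infty}p_i<1,\\[2mm] \infty, & \text{otherwise.}\end{cases} \]
   Context: For $\theta>0$ and $\alpha\in(0,1)$, let $U_1,U_2,\ldots$ be independent random variables such that $U_k$ has the $Beta(1-\alpha,\theta+k\alpha)$ distribution, and set $X_1^{\theta,\alpha}=U_1$, $X_n^{\theta,\alpha}=(1-U_1)\cdots(1-U_{n-1})U_n$ for $n\ge 2$; almost surely $\sum_k X_k^{\theta,\alpha}=1$. Let ${\bf P}(\theta,\alpha)=(P_1(\theta,\alpha),P_2(\theta,\alpha),\ldots)$ denote the sequence $(X_1^{\theta,\alpha},X_2^{\theta,\alpha},\ldots)$ arranged in descending order; its law is the two-parameter Poisson-Dirichlet distribution $PD(\theta,\alpha)$. The space $\bar\nabla$ carries the topology generated by the metric $d({\bf p},{\bf q})=\sum_{i=1}^{\infty}|p_i-q_i|/2^i$, for which it is compact. A family of probability measures $\{Q_\theta:\theta>0\}$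 on a topological space $\mathcal{X}$ satisfies a large deviation principle (as $\theta\to\infty$) with speed $\theta$ and rate function $I:\mathcal{X}\to[0,\infty]$ if $I$ is lower semicontinuous, $\limsup_{\theta\to\infty}\frac1\theta\log Q_\theta(F)\le-\inf_{x\in F}I(x)$ for every closed $F\subset\mathcal{X}$, and $\liminf_{\theta\to\infty}\frac1\theta\log Q_\theta(G)\ge-\inf_{x\in G}I(x)$ for every open $G\subset\mathcal{X}$. *)

(* Defs.v *)
From HB Require Import structures.
From mathcomp Require Import all_boot all_order all_algebra finmap.
From mathcomp Require Import all_classical all_reals all_analysis.
Set Implicit Arguments.
Unset Strict Implicit.
Unset Printing Implicit Defensive.
Import Order.TTheory GRing.Theory Num.Theory.
Import numFieldNormedType.Exports.
Local Open Scope classical_set_scope.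
Local Open Scope ring_scope.

(* Sequences are indexed from 0: p i stands for p_(i+1).  The sum is taken in
   \bar R, so that the bound by 1 also asserts convergence. *)
Record nabla (R : realType) := Nabla {
  nabla_seq :> nat -> R ;
  nabla_noninc : forall i j, (i <= j)%N -> nabla_seq j <= nabla_seq i ;
  nabla_ge0 : forall i, 0 <= nabla_seq i ;
  nabla_sum_le1 : (\sum_(i <oo) (nabla_seq i)%:E <= 1)%E }.

Section nabla_metric.
Context {R : realType}.
Implicit Types p q r : nabla R.

Definition nabla_sum p : R := fine (\sum_(i <oo) (p i)%:E)%E.

Definition nabla_dist p q : R :=
  fine (\sum_(i <oo) (`|p i - q i| / 2 ^+ i.+1)%:E)%E.

Lemma nabla_inj p q : (forall i, p i = q i) -> p = q.
Proof.
case: p q => [p p1 p2 p3] [q q1 q2 q3] /= /funext pq; subst q.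
by congr Nabla; exact: Prop_irrelevance.
Qed.

Let term_ge0 p q (i : nat) : (0 <= (`|p i - q i| / 2 ^+ i.+1)%:E)%E.
Proof. by rewrite lee_fin divr_ge0. Qed.

Let dist_fin p q :
  (\sum_(i <oo) (`|p i - q i| / 2 ^+ i.+1)%:E)%E \is a fin_num.
Proof.
rewrite ge0_fin_numE; last by apply: nneseries_ge0 => i _ _; exact: term_ge0.
apply: (@le_lt_trans _ _ (\sum_(i <oo) ((p i)%:E + (q i)%:E))%E).
  apply: lee_nneseries => [i _ _|i _]; first exact: term_ge0.
  rewrite -EFinD lee_fin ler_pdivrMr//.
  apply: (@le_trans _ _ (p i + q i)).
    by rewrite (le_trans (ler_normB _ _))// !ger0_norm ?nabla_ge0.
  by rewrite ler_peMr ?addr_ge0 ?nabla_ge0// -natrX ler1n expn_gt0.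
rewrite nneseriesD; try by move=> i _ _; rewrite lee_fin nabla_ge0.
by rewrite lte_add_pinfty// (le_lt_trans (nabla_sum_le1 _))// ltry.
Qed.

Let dist_xx p : nabla_dist p p = 0.
Proof.
by rewrite /nabla_dist eseries0// => i _ _; rewrite subrr normr0 mul0r.
Qed.

Let dist_eq0 p q : nabla_dist p q = 0 -> p = q.
Proof.
move=> /eqP; rewrite fine_eq0// => /eqP d0; apply: nabla_inj => i.
have := @nneseries_lim_ge _ (fun k => (`|p k - q k| / 2 ^+ k.+1)%:E)%E
  xpredT 0 i.+1 (fun k _ _ => term_ge0 p q k).
rewrite d0 big_mkord big_ord_recr/= => h.
have : ((`|p i - q i| / 2 ^+ i.+1)%:E <= 0)%E.
  by apply: le_trans h; rewrite leeDr// sume_ge0.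
rewrite lee_fin pmulr_lle0 ?invr_gt0 ?exprn_gt0// normr_le0 subr_eq0.
by move/eqP.
Qed.

Let dist_sym p q : nabla_dist p q = nabla_dist q p.
Proof.
by rewrite /nabla_dist; congr fine; apply: eq_eseriesr => i _; rewrite distrC.
Qed.

Let dist_triangle q p r : nabla_dist p r <= nabla_dist p q + nabla_dist q r.
Proof.
rewrite /nabla_dist -fineD// fine_le ?fin_numD ?dist_fin//.
rewrite -nneseriesD; try by move=> i _ _; exact: term_ge0.
apply: lee_nneseries => [i _ _|i _]; first exact: term_ge0.
rewrite -EFinD lee_fin -mulrDl ler_wpM2r ?invr_ge0 ?exprn_ge0//.
by rewrite (le_trans _ (ler_normD _ _))// addrA subrK.
Qed.

Let zero_noninc (i j : nat) : (i <= j)%N -> (0 : R) <= 0.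
Proof. by []. Qed.

Let zero_ge0 (i : nat) : (0 : R) <= 0.
Proof. by []. Qed.

Let zero_sum : (\sum_(i <oo) (0 : R)%:E <= 1)%E.
Proof. by rewrite eseries0. Qed.

Definition nabla0 : nabla R := @Nabla R (fun=> 0) zero_noninc zero_ge0 zero_sum.

HB.instance Definition _ := gen_eqMixin (nabla R).
HB.instance Definition _ := gen_choiceMixin (nabla R).
HB.instance Definition _ := isPointed.Build (nabla R) nabla0.
HB.instance Definition _ := isMetric.Build R (nabla R)
  dist_xx dist_eq0 dist_sym dist_triangle.

End nabla_metric.

Definition borel (X : ptopologicalType) := g_sigma_algebraType (@open X).

(* lne 0 = -oo and ereal_inf set0 = +oo, so null sets and the empty set need
   no special treatment.  The family matters only for theta > 0. *)
Definition large_deviation_principle (R : realType) (X : ptopologicalType)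
    (Q : R -> probability (borel X) R) (I : X -> \bar R) : Prop :=
  [/\ forall x, (0 <= I x)%E,
      lower_semicontinuous I,
      forall F : set X, closed F ->
        (limf_esup (fun theta : R => theta^-1%:E * lne (Q theta F)) (+oo)%R
           <= - ereal_inf [set I x | x in F])%E &
      forall G : set X, open G ->
        (- ereal_inf [set I x | x in G]
           <= limf_einf (fun theta : R => theta^-1%:E * lne (Q theta G)) (+oo)%R)%E].

Definition mutually_independent (R : realType) (d d' : measure_display)
    (Omega : measurableType d) (T : measurableType d') (P : probability Omega R)
    (U : nat -> {RV P >-> T}) : Prop :=
  forall (J : {fset nat}) (A : nat -> set T),
    (forall k, measurable (A k)) ->
    P (\bigcap_(k in [set` J]) (U k @^-1` A k)) =
      (\prod_(k <- J) P (U k @^-1` A k))%E.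

(* The library's beta_prob only has natural number parameters. *)
Definition beta_weight (R : realType) (a b x : R) : R :=
  x `^ (a - 1) * (1 - x) `^ (b - 1).

Definition beta_density (R : realType) (a b x : R) : R :=
  beta_weight a b x /
    \int[lebesgue_measure]_(y in `]0, 1[) beta_weight a b y.

Definition has_beta_distribution (R : realType) (d : measure_display)
    (Omega : measurableType d) (P : probability Omega R) (X : {RV P >-> R})
    (a b : R) : Prop :=
  forall A : set R, measurable A ->
    distribution P X A =
      (\int[lebesgue_measure]_(x in A `&` `]0%R, 1%R[) (beta_density a b x)%:E)%E.

Definition stick_breaking (R : realType) (u : nat -> R) (n : nat) : R :=
  (\prod_(i < n) (1 - u i)) * u n.

Definition descending_arrangement (R : realType) (x p : nat -> R) : Prop :=
  (forall i j, (i <= j)%N -> p j <= p i) /\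
  exists2 s : nat -> nat, bijective s & forall i, p i = x (s i).

(* Q is the law of the descending arrangement of the stick-breaking sequence;
   that arrangement exists almost surely (when all terms are positive and tend
   to 0), hence the almost sure equality.  U k stands for U_(k+1). *)
Definition is_poisson_dirichlet (R : realType) (theta alpha : R)
    (Q : probability (borel (nabla R)) R) : Prop :=
  exists (d : measure_display) (Omega : measurableType d)
    (P : probability Omega R) (U : nat -> {RV P >-> R})
    (V : {RV P >-> borel (nabla R)}),
    [/\ mutually_independent U,
        forall k, has_beta_distribution (U k) (1 - alpha) (theta + k.+1%:R * alpha),
        {ae P, forall w,
           descending_arrangement (stick_breaking (U ^~ w)) (V w : nabla R)} &
        forall A : set (borel (nabla R)), measurable A -> Q A = distribution P V A].

Definition pd_rate (R : realType) (p : nabla R) : \bar R :=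
  if nabla_sum p < 1 then (ln (1 / (1 - nabla_sum p)))%:E else +oo%E.

(* Main.v *)
Require Import Defs.
From mathcomp Require Import all_boot all_order all_algebra finmap.
From mathcomp Require Import all_classical all_reals all_analysis.
From mathcomp Require Import measurable_realfun zify ring lra.
Set Implicit Arguments.
Unset Strict Implicit.
Unset Printing Implicit Defensive.
Import Order.TTheory GRing.Theory Num.Theory.
Import numFieldNormedType.Exports.
Local Open Scope classical_set_scope.
Local Open Scope ring_scope.

(** Write X for the stick-breaking sequence, U for the independent breaks and
    V for the sorted sequence.  For theta large the density of each U k behaves
    like (1 - x) ^ theta, so that keeping U k near x costs (1 - x) ^ theta, and
    keeping U k near 0 costs nothing on the exponential scale.  Since the pieces
    X 0, ..., X (n - 1) leave the product of the 1 - U k, k < n, building pieces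
    of total mass s costs (1 - s) ^ theta, whatever they are individually.  This
    is the rate function - ln (1 - sum p).

    Lower bound (poisson_dirichlet_lower).  Let p have total mass less than 1.
    Require U k to be near the break that produces p k for k < n, and below a
    small g for k >= n.  The first requirement has probability at least
    (1 - sum p - e) ^ theta; given it, the second one fails with probability at
    most 1/2, by a union bound over single indices (independent_avoid).  The
    pieces are then uniformly close to p.  Sorting is a contraction for the
    uniform distance (descending_arrangement_close), so V is close to p.

    Upper bound (poisson_dirichlet_upper).  Let F be closed, with total masses
    greater than s.  By compactness and Dini's argument (closed_partial_sum)
    there is an n such that the n largest pieces already exceed s for every point
    of F.  The sum of X k over a finite set of indices is at most 1 minus the
    product of the 1 - U k over the same indices (sum_stick_breaking_le), so n
    independent variables 1 - U k have a product less than 1 - s.  Each of them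
    is below y with probability of order y ^ theta, and discretising the n
    factors on a geometric grid (grid_cover) yields (1 - s) ^ theta for fixed
    indices.  It remains to bound the number of choices of the n indices.  After
    N breaks the remaining stick is shorter than delta except with probability
    exp (- C theta), where C is as large as desired and N is proportional to
    theta (stick_left_probability): in each of B dyadic blocks of indices beyond
    theta the breaks are of order 1 / k, and a block fails to contribute a fixed
    amount to the sum of the breaks with probability at most 2 ^ - m, m being its
    length.  Hence only indices of order theta matter, and the union bound costs
    a factor polynomial in theta.

    All one-variable estimates (beta_upper_tail, beta_lower_tail, beta_interval)
    follow from elementary bounds on the beta integrand and from the integral of
    x ^ (a - 1). *)

(** * The beta distribution *)

Section beta.
Context {R : realType}.
Local Notation mu := (@lebesgue_measure R).

Lemma measurable_beta_weight (a b : R) (D : set R) :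
  measurable_fun D (EFin \o beta_weight a b).
Proof.
apply/measurable_funTS/measurable_EFinP; apply: measurable_funM.
  exact: measurable_powR.
apply: (@measurableT_comp _ _ _ _ _ _ (@powR R ^~ (b - 1))).
  exact: measurable_powR.
exact: measurable_funB.
Qed.

Lemma beta_weight_ge0 (a b x : R) : 0 <= beta_weight a b x.
Proof. by rewrite mulr_ge0 ?powR_ge0. Qed.

Lemma integral_powR_cc (a s t : R) : 0 < a -> 0 < s -> s < t ->
  (\int[mu]_(x in `[s, t]) (x `^ (a - 1))%:E = (t `^ a / a - s `^ a / a)%:E)%E.
Proof.
move=> a0 s0 st.
have dF (x : R) : 0 < x ->
    is_derive x 1 (fun y : R => y `^ a / a) (x `^ (a - 1)).
  move=> x0; have h := is_derive1_powR a x0.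
  have -> : (fun y : R => y `^ a / a) = (fun y => a^-1 *: (y `^ a)).
    by apply/funext => y; rewrite mulrC.
  apply: is_derive_eq.
  by rewrite -[LHS]/(a^-1 * (a * x `^ (a - 1))) mulrA mulVf ?mul1r// gt_eqF.
have cF (x : R) : 0 < x -> {for x, continuous (fun y : R => y `^ a / a)}.
  move=> x0; apply: differentiable_continuous; apply/derivable1_diffP.
  by have [] := dF _ x0.
rewrite EFinB.
apply: (@continuous_FTC2 _ (fun x => x `^ (a - 1)) (fun y => y `^ a / a)) => //.
- apply: continuous_in_subspaceT => x; rewrite inE /= in_itv /= => /andP[sx _].
  apply: differentiable_continuous; apply/derivable1_diffP.
  by apply: derivable_powR; rewrite in_itv/= andbT (lt_le_trans s0).
- split.
  + move=> x; rewrite in_itv/= => /andP[sx _].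
    by have [] := dF _ (lt_trans s0 sx).
  + by apply: cvg_at_right_filter; exact: cF.
  + by apply: cvg_at_left_filter; apply: cF; exact: lt_trans st.
- move=> x; rewrite in_itv/= => /andP[sx _]; rewrite derive1E.
  by have [_ ->] := dF _ (lt_trans s0 sx).
Qed.

(** The integrand is unbounded at 0 when a < 1: the integral is the increasing
    limit of those over [t / (n + 2), t]. *)
Lemma integral_powR_oo (a t : R) : 0 < a -> 0 < t ->
  (\int[mu]_(x in `]0%R, t[) (x `^ (a - 1))%:E = (t `^ a / a)%:E)%E.
Proof.
move=> a0 t0.
have mf D : measurable_fun D (fun x : R => (x `^ (a - 1))%:E).
  by apply/measurable_funTS/measurable_EFinP; exact: measurable_powR.
rewrite (integral_itv_bndo_bndc (mf _)).
pose s n : R := t / n.+2%:R.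
have s0 n : 0 < s n by rewrite divr_gt0.
have st n : s n < t by rewrite ltr_pdivrMr// ltr_pMr// ltr1n.
have -> : `]0, t]%classic = \bigcup_n `[s n, t]%classic.
  apply/seteqP; split=> [x|x [n _]] /=; rewrite !in_itv/= => /andP[x0 xt].
    have [n _ tn] := near_infty_natSinv_lt (PosNum (divr_gt0 x0 t0)).
    exists n => //=; rewrite in_itv/= xt andbT.
    have := tn n (leqnn n); rewrite /= ltr_pdivlMr// => h.
    rewrite /s mulrC (le_trans _ (ltW h))//.
    by rewrite ler_wpM2r ?(ltW t0)// lef_pV2 ?posrE// ler_nat.
  by rewrite xt (lt_le_trans (s0 n)).
have h1 : (\int[mu]_(x in `[s n, t]) (x `^ (a - 1))%:E)%E @[n --> \oo] -->
    (\int[mu]_(x in \bigcup_n `[s n, t]%classic) (x `^ (a - 1))%:E)%E.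
  apply: ge0_nondecreasing_set_cvg_integral => //.
  - apply/nondecreasing_seqP => n; rewrite subsetEset => x /=; rewrite !in_itv/=.
    move=> /andP[sx ->]; rewrite andbT (le_trans _ sx)//.
    by rewrite ler_wpM2l ?(ltW t0)// lef_pV2 ?posrE// ler_nat.
  - by move=> n; exact: mf.
  - by move=> n x _; rewrite lee_fin powR_ge0.
rewrite -(cvg_lim _ h1)//; apply: cvg_lim => //.
rewrite (_ : (fun n => _) = fun n => (t `^ a / a - s n `^ a / a)%:E); last first.
  by apply/funext => n; rewrite integral_powR_cc.
apply: cvg_EFin; first by near=> n.
rewrite [X in _ --> X](_ : _ = t `^ a / a - 0 / a); last by rewrite mul0r subr0.
apply: cvgB; first exact: cvg_cst.
apply: cvgMl.
have /cvg_at_rightP h := powR_cvg0 a0.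
apply: h; split=> //.
rewrite [X in _ --> X](_ : _ = t * 0); last by rewrite mulr0.
apply: cvgMr.
have := @cvg_harmonic R; rewrite -(cvg_shiftS (@harmonic R)); exact.
Unshelve. all: by end_near. Qed.

(** The normalising constant is an integral read in R, hence 0 if it diverges;
    the total mass being 1 excludes both divergence and vanishing. *)
Lemma has_beta_mass (d : measure_display) (Omega : measurableType d)
    (P : probability Omega R) (X : {RV P >-> R}) (a b : R) :
  has_beta_distribution X a b ->
  exists2 Z : R, 0 < Z &
    (\int[mu]_(x in `]0%R, 1%R[) (beta_weight a b x)%:E = Z%:E)%E /\
    forall A : set R, measurable A ->
      (P (X @^-1` A) = (Z^-1)%:E *
         \int[mu]_(x in A `&` `]0%R, 1%R[) (beta_weight a b x)%:E)%E.
Proof.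
move=> hX; pose W := (\int[mu]_(x in `]0%R, 1%R[) (beta_weight a b x)%:E)%E.
have key (A : set R) : measurable A -> (P (X @^-1` A) = (fine W)^-1%:E *
      \int[mu]_(x in A `&` `]0%R, 1%R[) (beta_weight a b x)%:E)%E.
  move=> mA; rewrite -[LHS]/(distribution P X A) hX//.
  rewrite -ge0_integralZl_EFin//.
  - by apply: eq_integral => x _; rewrite /beta_density mulrC EFinM.
  - exact: measurableI.
  - by move=> x _; rewrite lee_fin beta_weight_ge0.
  - exact: measurable_beta_weight.
  - rewrite invr_ge0 fine_ge0// integral_ge0// => x _.
    by rewrite lee_fin beta_weight_ge0.
have W0 : (0 <= W)%E.
  by apply: integral_ge0 => x _; rewrite lee_fin beta_weight_ge0.
have h1 := key setT measurableT.
rewrite preimage_setT probability_setT setTI -/W in h1.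
have Wf : W \is a fin_num.
  by move: W W0 {key} h1 => [] // _ /=; rewrite invr0 mul0e => /eqP; rewrite onee_eq0.
exists (fine W); last by rewrite fineK.
rewrite lt_neqAle fine_ge0// andbT eq_sym.
by apply/eqP => z0; move: h1; rewrite z0 invr0 mul0e => /eqP; rewrite onee_eq0.
Qed.

Lemma ler_powR_base (x y c : R) : 0 <= c -> 0 <= x -> x <= y ->
  x `^ c <= y `^ c.
Proof.
move=> c0 x0 xy; apply: ge0_ler_powR => //; rewrite nnegrE//.
exact: le_trans xy.
Qed.

Lemma powRVl (x c : R) : 0 <= x -> x^-1 `^ c = (x `^ c)^-1.
Proof. by move=> x0; rewrite -powR_inv1// -powRrM mulN1r powRN. Qed.

Lemma powR_le1 (x c : R) : 0 <= c -> 0 <= x <= 1 -> x `^ c <= 1.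
Proof.
move=> c0 /andP[x0 x1]; have := ler_powR_base c0 x0 x1.
by rewrite powR1.
Qed.

Lemma powR_inv_ge1 (x c : R) : 0 < x <= 1 -> c <= 0 -> 1 <= x `^ c.
Proof.
move=> /andP[x0 x1] c0; rewrite -[c]opprK powRN invf_ge1 ?powR_gt0//.
by rewrite powR_le1 ?oppr_ge0// (ltW x0).
Qed.

Lemma beta_weight_ge_powR (a b x t : R) : 1 <= b -> 0 < x < t -> t < 1 ->
  (1 - t) `^ (b - 1) * x `^ (a - 1) <= beta_weight a b x.
Proof.
move=> b1 /andP[x0 xt] t1; rewrite mulrC /beta_weight ler_wpM2l ?powR_ge0//.
by apply: ler_powR_base; lra.
Qed.

Lemma beta_weight_le_powR (a b x : R) : 1 <= b -> 0 < x < 1 ->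
  beta_weight a b x <= x `^ (a - 1).
Proof.
move=> b1 /andP[x0 x1]; rewrite /beta_weight ler_piMr ?powR_ge0//.
by apply: powR_le1; lra.
Qed.

(** The factor x ^ (a - 1) is at least 1 for x <= 1, and the factor
    (1 - x) ^ (b - 1) is decreasing. *)
Lemma beta_weight_lb (a b x y : R) : a <= 1 -> 1 <= b -> 0 < x <= y -> y < 1 ->
  (1 - y) `^ (b - 1) <= beta_weight a b x.
Proof.
move=> a1 b1 /andP[x0 xy] y1.
rewrite -[leLHS]mul1r ler_pM ?powR_ge0//.
  by apply: powR_inv_ge1; [rewrite x0 (le_trans xy)// ltW|rewrite subr_le0].
by apply: ler_powR_base; lra.
Qed.

Lemma integral_cst_oo (s t c : R) : s <= t ->
  (\int[mu]_(x in `]s, t[) (cst c%:E) x)%E = ((t - s) * c)%:E.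
Proof.
move=> st; rewrite integral_cst//= lebesgue_measure_itv/= lte_fin.
case: ltP => [_|ts]; first by rewrite -EFinB -EFinM mulrC.
by rewrite mule0 (_ : t - s = 0) ?mul0r//; lra.
Qed.

Lemma integral_itv_lb (f : R -> R) (s t c : R) : s <= t -> 0 <= c ->
  measurable_fun `]s, t[ f -> {in `]s, t[, forall x, c <= f x} ->
  (((t - s) * c)%:E <= \int[mu]_(x in `]s, t[) (f x)%:E)%E.
Proof.
move=> st c0 mf cf.
rewrite -integral_cst_oo//.
apply: ge0_le_integral => //.
exact/measurable_EFinP.
Qed.

Lemma integral_itv_ub (f : R -> R) (s t c : R) : s <= t -> 0 <= c ->
  measurable_fun `]s, t[ f -> {in `]s, t[, forall x, 0 <= f x <= c} ->
  (\int[mu]_(x in `]s, t[) (f x)%:E <= ((t - s) * c)%:E)%E.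
Proof.
move=> st c0 mf cf.
rewrite -integral_cst_oo//.
apply: ge0_le_integral => //.
- by move=> x /= /cf; rewrite lee_fin => /andP[].
- exact/measurable_EFinP.
- by move=> x /cf; rewrite lee_fin => /andP[].
Qed.

Section beta_law.
Context (d : measure_display) (Omega : measurableType d)
  (P : probability Omega R) (X : {RV P >-> R}) (a b : R).

Lemma beta_as01 : has_beta_distribution X a b ->
  P (X @^-1` (~` `]0%R, 1%R[)) = 0%E.
Proof.
move=> hX; have [Z Z0 [_ ->]] := has_beta_mass hX; last by apply: measurableC.
by rewrite setICl integral_set0 mule0.
Qed.

Lemma beta_mass_lb (Z t : R) : 0 < a -> 1 <= b -> 0 < t < 1 ->
  (\int[mu]_(x in `]0%R, 1%R[) (beta_weight a b x)%:E)%E = Z%:E ->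
  (1 - t) `^ (b - 1) * (t `^ a / a) <= Z.
Proof.
move=> a0 b1 /andP[t0 t1] ZE.
rewrite -lee_fin -ZE EFinM -integral_powR_oo// -ge0_integralZl_EFin ?powR_ge0//.
- apply: (@le_trans _ _ (\int[mu]_(x in `]0%R, t[) (beta_weight a b x)%:E)%E).
    apply: ge0_le_integral => //.
    + by move=> x _; rewrite -EFinM lee_fin mulr_ge0 ?powR_ge0.
    + apply: measurable_funeM; apply/measurable_funTS/measurable_EFinP.
      exact: measurable_powR.
    + exact: measurable_beta_weight.
    move=> x /=; rewrite in_itv/= => xt; rewrite -EFinM lee_fin.
    exact: beta_weight_ge_powR.
  apply: ge0_subset_integral => //.
  + exact: measurable_beta_weight.
  + by move=> x _; rewrite lee_fin beta_weight_ge0.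
  + by apply: subset_itvl; rewrite bnd_simp ltW.
- by move=> x _; rewrite lee_fin powR_ge0.
- by apply/measurable_funTS/measurable_EFinP; exact: measurable_powR.
Qed.

Lemma beta_mass_ub (Z : R) : 0 < a -> 1 <= b ->
  (\int[mu]_(x in `]0%R, 1%R[) (beta_weight a b x)%:E)%E = Z%:E -> Z <= a^-1.
Proof.
move=> a0 b1 ZE; rewrite -lee_fin -ZE.
have := integral_powR_oo a0 (@ltr01 R); rewrite powR1 div1r => <-.
apply: ge0_le_integral => //.
- by move=> x _; rewrite lee_fin beta_weight_ge0.
- exact: measurable_beta_weight.
- by apply/measurable_funTS/measurable_EFinP; exact: measurable_powR.
move=> x /=; rewrite in_itv/= => x01; rewrite lee_fin.
exact: beta_weight_le_powR.
Qed.

(** On [1 - y, 1[ the weight is at most (1 - y) ^ (a - 1) y ^ (b - 1), and the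
    normalising constant is at least eta (1 - eta) ^ b by restriction to
    ]0, eta[.  The factor 1 - eta lost in the base can be taken as close to 1 as
    needed, so no sharper bound on the constant is required. *)
Lemma beta_upper_tail (y eta : R) : 0 < a < 1 -> 1 < b ->
  has_beta_distribution X a b -> 0 < y < 1 -> 0 < eta < 1 ->
  (P (X @^-1` `[(1 - y)%R, +oo[) <=
     ((1 - y) `^ (a - 1) / eta * (y / (1 - eta)) `^ b)%:E)%E.
Proof.
move=> /andP[a0 a1] b1 hX /andP[y0 y1] /andP[e0 e1].
have [Z Z0 [ZE ->]] := has_beta_mass hX; last exact: measurable_itv.
have -> : `[1 - y, +oo[ `&` `]0, 1[ = `[1 - y, 1[%classic :> set R.
  apply/seteqP; split=> x /=; rewrite !in_itv/= ?andbT.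
    by move=> [-> /andP[_ ->]].
  by move=> /andP[yx x1]; rewrite yx x1; split => //; rewrite andbT; lra.
rewrite -integral_itv_obnd_cbnd; last exact: measurable_beta_weight.
have h : (\int[mu]_(x in `](1 - y)%R, 1%R[) (beta_weight a b x)%:E <=
    ((1 - (1 - y)) * ((1 - y) `^ (a - 1) * y `^ (b - 1)))%:E)%E.
  apply: integral_itv_ub; rewrite ?mulr_ge0 ?powR_ge0//; first lra.
    by apply/measurable_EFinP; exact: measurable_beta_weight.
  move=> x; rewrite in_itv/= => /andP[yx x1]; rewrite beta_weight_ge0/=.
  rewrite /beta_weight ler_pM ?powR_ge0//; last first.
    by apply: ler_powR_base; lra.
  rewrite -[a - 1]opprK powRN [leRHS]powRN lef_pV2 ?posrE ?powR_gt0//; try lra.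
  by apply: ler_powR_base; lra.
have hZ : eta * (1 - eta) `^ b <= Z.
  apply: le_trans (@beta_mass_lb _ eta a0 (ltW b1) _ ZE); last by rewrite e0.
  rewrite mulrC ler_pM ?powR_ge0 ?(ltW e0)//.
    by apply: ger_powR; lra.
  have ea : eta `^ 1 <= eta `^ a by apply: ger_powR; lra.
  rewrite powRr1 ?(ltW e0)// in ea.
  by rewrite ler_pdivlMr// (le_trans _ ea)// ler_piMr ?ltW.
rewrite muleC; apply: le_trans (lee_wpmul2r _ h) _.
  by rewrite lee_fin invr_ge0 ltW.
rewrite -EFinM lee_fin subKr ler_pdivrMr//.
have e1' : 0 < 1 - eta by lra.
rewrite powRM ?invr_ge0 ?(ltW y0) ?(ltW e1')//.
rewrite powRVl ?(ltW e1')//.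
apply: le_trans (ler_wpM2l _ hZ); last first.
  by rewrite !mulr_ge0 ?powR_ge0 ?invr_ge0 ?powR_ge0// ltW.
rewrite -(@mulr_powRB1 _ y b) ?(ltW y0)//; last lra.
have : (1 - eta) `^ b != 0 by rewrite gt_eqF ?powR_gt0.
have : eta != 0 by rewrite gt_eqF.
set A := (1 - y) `^ (a - 1); set B := y `^ (b - 1); set C := (1 - eta) `^ b.
by move=> n1 n2; rewrite le_eqVlt; apply/orP; left; apply/eqP; field; apply/andP.
Qed.

Lemma expRN1_le (c : R) : 1 < c -> expR (-1) <= (1 - c^-1) `^ (c - 1).
Proof.
move=> c1; have c0 : 0 < c - 1 by lra.
have -> : 1 - c^-1 = (1 + (c - 1)^-1)^-1.
  by field; rewrite !gt_eqF//=; lra.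
have h0 : 0 < 1 + (c - 1)^-1 by rewrite addr_gt0// invr_gt0.
rewrite powRVl ?(ltW h0)// expRN lef_pV2 ?posrE ?powR_gt0 ?expR_gt0//.
have := ler_powR_base (ltW c0) (ltW h0) (expR_ge1Dx (c - 1)^-1).
by rewrite -expRM mulVf ?gt_eqF.
Qed.

(** The bound is uniform in b on the scale t = O (1 / b), which is where the
    distribution lives; this needs the normalising constant up to a factor,
    obtained by restriction to ]0, 1 / b[. *)
Lemma beta_lower_tail (t : R) : 0 < a -> 1 < b ->
  has_beta_distribution X a b -> 0 < t <= 1 ->
  (P (X @^-1` `]-oo, t[) <= (expR 1 * (b * t) `^ a)%:E)%E.
Proof.
move=> a0 b1 hX /andP[t0 t1].
have [Z Z0 [ZE ->]] := has_beta_mass hX; last exact: measurable_itv.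
have -> : `]-oo, t[ `&` `]0, 1[ = `]0, t[%classic :> set R.
  apply/seteqP; split=> x /=; rewrite !in_itv/=.
    by move=> [-> /andP[->]].
  by move=> /andP[x0 xt]; rewrite xt x0; split => //; rewrite (lt_le_trans xt).
have h : (\int[mu]_(x in `]0%R, t[) (beta_weight a b x)%:E <= (t `^ a / a)%:E)%E.
  rewrite -integral_powR_oo//; apply: ge0_le_integral => //.
  - by move=> x _; rewrite lee_fin beta_weight_ge0.
  - exact: measurable_beta_weight.
  - by apply/measurable_funTS/measurable_EFinP; exact: measurable_powR.
  move=> x /=; rewrite in_itv/= => /andP[x0 xt]; rewrite lee_fin.
  by apply: beta_weight_le_powR; rewrite ?ltW// x0 (lt_le_trans xt).
have hZ : expR (-1) * (b^-1 `^ a / a) <= Z.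
  apply: le_trans (@beta_mass_lb _ b^-1 a0 (ltW b1) _ ZE).
    by rewrite ler_wpM2r ?expRN1_le// divr_ge0 ?powR_ge0 ?ltW.
  by rewrite invr_gt0 invf_lt1 ?b1 ?andbT; lra.
rewrite muleC; apply: le_trans (lee_wpmul2r _ h) _.
  by rewrite lee_fin invr_ge0 ltW.
rewrite -EFinM lee_fin ler_pdivrMr//.
apply: le_trans (ler_wpM2l _ hZ); last by rewrite mulr_ge0 ?powR_ge0 ?expR_ge0.
have b0 : 0 < b by lra.
rewrite powRVl ?(ltW b0)// powRM ?(ltW b0) ?(ltW t0)// expRN.
have : b `^ a != 0 by rewrite gt_eqF ?powR_gt0.
have : expR 1 != 0 :> R by rewrite gt_eqF ?expR_gt0.
have : a != 0 by rewrite gt_eqF.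
set A := b `^ a; set B := t `^ a; set C := expR 1.
move=> n1 n2 n3; rewrite le_eqVlt; apply/orP; left; apply/eqP; field.
by apply/and3P.
Qed.

Lemma beta_interval (v l : R) : 0 < a < 1 -> 1 < b ->
  has_beta_distribution X a b -> 0 <= v -> 0 < l -> v + l < 1 ->
  ((a * l * (1 - (v + l)) `^ b)%:E <= P (X @^-1` `]v, (v + l)%R[))%E.
Proof.
move=> /andP[a0 a1] b1 hX v0 l0 vl1.
have [Z Z0 [ZE ->]] := has_beta_mass hX; last exact: measurable_itv.
have -> : `]v, (v + l)[ `&` `]0, 1[ = `]v, (v + l)[%classic :> set R.
  apply/seteqP; split=> x /=; rewrite !in_itv/=; first by case.
  by move=> /andP[vx xl]; rewrite vx xl; split => //; apply/andP; split; lra.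
have h : (((v + l - v) * (1 - (v + l)) `^ (b - 1))%:E <=
    \int[mu]_(x in `]v, (v + l)%R[) (beta_weight a b x)%:E)%E.
  apply: integral_itv_lb; rewrite ?powR_ge0//; first lra.
    by apply/measurable_EFinP; exact: measurable_beta_weight.
  move=> x; rewrite in_itv/= => /andP[vx xl].
  by apply: beta_weight_lb; rewrite ?(ltW a1) ?(ltW b1) ?vl1 ?(ltW xl) ?andbT//; lra.
have hZ := beta_mass_ub a0 (ltW b1) ZE.
rewrite muleC; apply: le_trans (lee_wpmul2r _ h); last first.
  by rewrite lee_fin invr_ge0 ltW.
rewrite -EFinM lee_fin ler_pdivlMr// addrAC subrr add0r.
have lb : (1 - (v + l)) `^ b <= (1 - (v + l)) `^ (b - 1).
  by apply: ger_powR; lra.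
have aZ : a * Z <= 1 by rewrite mulrC -ler_pdivlMr// div1r.
rewrite (_ : _ * Z = a * Z * (l * (1 - (v + l)) `^ b)); last by ring.
rewrite (le_trans (ler_wpM2r _ aZ)) ?mul1r ?mulr_ge0 ?powR_ge0 ?(ltW l0)//.
by rewrite ler_wpM2l ?(ltW l0).
Qed.

End beta_law.
End beta.

(** * Stick breaking and sorting *)

Section deterministic.
Context {R : realType}.
Implicit Types (u x p v : nat -> R).

Definition stick_left u n : R := \prod_(i < n) (1 - u i).

Lemma stick_leftS u n : stick_left u n.+1 = stick_left u n * (1 - u n).
Proof. by rewrite /stick_left big_ord_recr. Qed.

Lemma stick_left_ge0 u n : (forall k, 0 <= u k <= 1) -> 0 <= stick_left u n.
Proof.
by move=> u01; apply: prodr_ge0 => i _; rewrite subr_ge0; case/andP: (u01 i).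
Qed.

Lemma stick_left_le1 u n : (forall k, 0 <= u k <= 1) -> stick_left u n <= 1.
Proof.
move=> u01; rewrite /stick_left.
by apply: prodr_ile1 => i _; have /andP[? ?] := u01 i; apply/andP; split; lra.
Qed.

Lemma stick_breaking_ge0 u n : (forall k, 0 <= u k <= 1) ->
  0 <= stick_breaking u n.
Proof.
move=> u01; rewrite /stick_breaking mulr_ge0 ?stick_left_ge0//.
by case/andP: (u01 n).
Qed.

Lemma stick_breakingE u n :
  stick_breaking u n = stick_left u n - stick_left u n.+1.
Proof. by rewrite stick_leftS /stick_breaking /stick_left; ring. Qed.

Lemma sum_stick_breaking u N M : (N <= M)%N ->
  \sum_(N <= k < M) stick_breaking u k = stick_left u N - stick_left u M.
Proof.
move=> NM; under eq_bigr do rewrite stick_breakingE -opprB.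
by rewrite sumrN telescope_sumr// opprB.
Qed.

(** A piece that is not removed can only increase what is left, so the indices
    outside P may be treated as if no break occurred there. *)
Lemma sum_stick_breaking_le u (P : pred nat) M : (forall k, 0 <= u k <= 1) ->
  \sum_(k < M | P k) stick_breaking u k <= 1 - \prod_(k < M | P k) (1 - u k).
Proof.
move=> u01; rewrite big_mkcond [in leRHS]big_mkcond/=.
elim: M => [|M IH]; first by rewrite !big_ord0 subrr.
rewrite !big_ord_recr/=.
set S := \sum_(i < M) _ in IH *; set Q := \prod_(i < M) _ in IH *.
case: (P M); last by rewrite addr0 mulr1.
have LQ : stick_left u M <= Q.
  apply: ler_prod => i _; have /andP[? ?] := u01 i.
  by case: (P i); apply/andP; split; lra.
have /andP[u0 _] := u01 M; have := ler_wpM2r u0 LQ.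
rewrite /stick_breaking -/(stick_left u M); lra.
Qed.

Lemma sum_injective_le (F : nat -> R) (s : nat -> nat) n N : injective s ->
  (forall k, 0 <= F k) -> exists2 M, (N <= M)%N &
  \sum_(i < n | (N <= s i)%N) F (s i) <= \sum_(N <= k < M) F k.
Proof.
move=> injs F0; pose M := (N + \max_(i < n) (s i).+1)%N.
have sM (i : 'I_n) : (s i < M)%N.
  rewrite /M (leq_trans _ (leq_addl N _))//.
  exact: (leq_bigmax (F := fun i : 'I_n => (s i).+1)).
exists M; first by rewrite leq_addr.
pose g (i : 'I_n) : 'I_M := Ordinal (sM i).
have injg : injective g by move=> i j /(congr1 val)/= /injs /val_inj.
rewrite (big_nat_widenl _ 0)//= big_mkord.
have <- : \sum_(k in g @: [set i : 'I_n | (N <= s i)%N]%SET) F k =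
    \sum_(i < n | (N <= s i)%N) F (s i).
  rewrite big_imset/=; last by move=> i j _ _; exact: injg.
  by apply: eq_bigl => i; rewrite inE.
rewrite [leLHS]big_mkcond [leRHS]big_mkcond/=; apply: ler_sum => k _.
case: ifPn => [/imsetP[i Ni ->]|_]; last by case: ifP.
by rewrite /=; move: Ni; rewrite inE => ->.
Qed.

(** The pieces with index at least N weigh less than delta together, so those
    with index below N weigh more than sigma - delta.  The indices N + i only
    serve to replace injectively the ones that are at least N. *)
Lemma top_pieces u (s : nat -> nat) n N (sigma delta : R) :
  (forall k, 0 <= u k <= 1) -> injective s ->
  sigma < \sum_(i < n) stick_breaking u (s i) -> stick_left u N < delta ->
  exists2 f : {ffun 'I_n -> 'I_(N + n)}, injective f &
    \prod_(i < n) (1 - u (f i)) < 1 - sigma + delta.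
Proof.
move=> u01 injs hs hN.
have x0 k : 0 <= stick_breaking u k by exact: stick_breaking_ge0.
pose h (i : 'I_n) := if (s i < N)%N then s i else (N + i)%N.
have hlt (i : 'I_n) : (h i < N + n)%N.
  by rewrite /h; case: ifPn => si; rewrite ?ltn_add2l// ltn_addr.
have injh : injective h.
  move=> i j; rewrite /h; case: ifPn => si; case: ifPn => sj.
  - by move=> /injs/val_inj.
  - by move=> e; move: si; rewrite e ltnNge leq_addr.
  - by move=> e; move: sj; rewrite -e ltnNge leq_addr.
  - by move=> /addnI /val_inj.
pose f := [ffun i => Ordinal (hlt i)].
have injf : injective f.
  by move=> i j; rewrite !ffunE => /(congr1 val)/= /injh.
exists f => //.
have [M NM hM] := sum_injective_le n N injs x0.
rewrite sum_stick_breaking// in hM.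
have L0 := stick_left_ge0 M u01.
have h1 : \sum_(i < n | (s i < N)%N) stick_breaking u (s i) <=
    \sum_(i < n) stick_breaking u (f i).
  rewrite big_mkcond; apply: ler_sum => i _; rewrite ffunE/= /h.
  by case: ifPn.
have h2 : \sum_(i < n) stick_breaking u (s i) =
    \sum_(i < n | (s i < N)%N) stick_breaking u (s i) +
    \sum_(i < n | (N <= s i)%N) stick_breaking u (s i).
  rewrite (bigID (fun i : 'I_n => (s i < N)%N))/=; congr (_ + _).
  by apply: eq_bigl => i; rewrite -leqNgt.
have := sum_stick_breaking_le (fun k => [exists i, val (f i) == k]) (N + n) u01.
have imE (k : 'I_(N + n)) : [exists i, val (f i) == k] = (k \in f @: [set: 'I_n]%SET).
  apply/existsP/imsetP => [[i /eqP e]|[i _ ->]]; last by exists i.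
  by exists i => //; apply: val_inj; rewrite e.
rewrite (eq_bigl _ _ imE) [in X in _ <= 1 - X](eq_bigl _ _ imE).
rewrite !big_imset/=; try by move=> i j _ _; exact: injf.
under eq_bigl do rewrite inE.
under [in X in _ <= 1 - X]eq_bigl do rewrite inE.
lra.
Qed.

Lemma injective_reaches (t : nat -> nat) i : injective t ->
  exists2 j, (j <= i)%N & (i <= t j)%N.
Proof.
move=> injt; apply: contrapT => h.
have lt (j : 'I_i.+1) : (t j < i)%N.
  rewrite ltnNge; apply/negP => ij; apply: h; exists j => //.
  by rewrite -ltnS.
pose g (j : 'I_i.+1) : 'I_i := Ordinal (lt j).
have injg : injective g by move=> j k /(congr1 val)/= /injt /val_inj.
by have := leq_card g injg; rewrite !card_ord ltnn.
Qed.

(** Sorting does not increase the uniform distance to a sorted sequence: both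
    bounds at rank i come from a pigeonhole argument on i + 1 indices. *)
Lemma descending_arrangement_close x p v (g : R) :
  (forall i j, (i <= j)%N -> p j <= p i) -> descending_arrangement x v ->
  (forall k, `|x k - p k| <= g) -> forall i, `|v i - p i| <= g.
Proof.
move=> p_dec [v_dec [s [t st ts] vE]] xp i; rewrite ler_norml; apply/andP; split.
  have [j ji it] := injective_reaches i (can_inj ts).
  have := p_dec _ _ ji; have := v_dec _ _ it; have := xp j.
  by rewrite ler_norml vE ts => /andP[]; lra.
have [j ji is'] := injective_reaches i (can_inj st).
have := p_dec _ _ is'; have := v_dec _ _ ji; have := xp (s j).
by rewrite ler_norml (vE j) => /andP[]; lra.
Qed.

Lemma dist_prod_le n (y z : nat -> R) :
  (forall i, 0 <= y i <= 1) -> (forall i, 0 <= z i <= 1) ->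
  `|\prod_(i < n) y i - \prod_(i < n) z i| <= \sum_(i < n) `|y i - z i|.
Proof.
move=> y01 z01; elim: n => [|n IH]; first by rewrite !big_ord0 subrr normr0.
rewrite !big_ord_recr/=.
set A := \prod_(i < n) y i in IH *; set B := \prod_(i < n) z i in IH *.
have -> : A * y n - B * z n = (A - B) * y n + B * (y n - z n) by ring.
have /andP[B0 B1] : 0 <= B <= 1.
  rewrite prodr_ge0 ?prodr_ile1//= => i _; last by case/andP: (z01 i).
have /andP[yn0 yn1] := y01 n.
rewrite (le_trans (ler_normD _ _))// !normrM (ger0_norm B0) (ger0_norm yn0).
by rewrite lerD//; [rewrite (le_trans _ IH)// ler_piMr|rewrite ler_piMl].
Qed.

(** Otherwise more than half of the M terms are at least 2c / M, and these alone
    sum to at least c. *)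
Lemma half_below u m M (c : R) : (forall k, 0 <= u k) -> (0 < M)%N ->
  \sum_(i < M) u (m + i)%N < c ->
  exists2 S : {set 'I_M}, (M <= 2 * #|S|)%N &
    forall i, i \in S -> u (m + i)%N < 2 * c / M%:R.
Proof.
move=> u0 M0 hc.
pose t := 2 * c / M%:R.
pose S := [set i : 'I_M | u (m + i)%N < t]%SET.
exists S; last by move=> i; rewrite inE.
have c0 : 0 < c by rewrite (le_lt_trans _ hc)// sumr_ge0.
have t0 : 0 < t by rewrite divr_gt0 ?mulr_gt0// ltr0n.
rewrite leqNgt; apply/negP => SM.
have h : #|~: S|%:R * t <= \sum_(i < M) u (m + i)%N.
  rewrite mulr_natl -sumr_const [leLHS]big_mkcond/=.
  by apply: ler_sum => i _; rewrite !inE; case: ifPn => //; rewrite -leNgt.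
have hcard : (#|S| + #|~: S| = M)%N by rewrite cardsC card_ord.
have arith a b : (2 * a < M)%N -> (a + b)%N = M -> (M <= 2 * b)%N by lia.
have := arith _ _ SM hcard.
rewrite -(ler_nat R) natrM => h2.
have : c <= #|~: S|%:R * t.
  rewrite /t mulrA ler_pdivlMr ?ltr0n//.
  by rewrite [leRHS](_ : _ = c * (2 * #|~: S|%:R)); [rewrite ler_wpM2l// ltW|ring].
lra.
Qed.

Lemma stick_left_le_expR u n : (forall k, 0 <= u k <= 1) ->
  stick_left u n <= expR (- \sum_(0 <= k < n) u k).
Proof.
move=> u01; elim: n => [|n IH].
  by rewrite /stick_left big_ord0 big_nil oppr0 expR0.
rewrite stick_leftS big_nat_recr//= opprD expRD ler_pM ?stick_left_ge0//.
- by rewrite subr_ge0; case/andP: (u01 n).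
- exact: expR_ge1Dx.
Qed.

(** A dyadic block [m, 2m) in which the breaks sum to at least c shortens the
    stick by the factor exp (- c), so that B blocks all of which are heavy would
    leave less than delta. *)
Lemma light_block u m0 B (c delta : R) : (forall k, 0 <= u k <= 1) ->
  expR (- (B%:R * c)) < delta -> delta <= stick_left u (m0 * 2 ^ B) ->
  exists i : 'I_B, \sum_(j < m0 * 2 ^ i) u (m0 * 2 ^ i + j)%N < c.
Proof.
move=> u01 hB hdelta; apply: contrapT => hno.
have hblock (i : 'I_B) : c <= \sum_(j < m0 * 2 ^ i) u (m0 * 2 ^ i + j)%N.
  by rewrite leNgt; apply/negP => hi; apply: hno; exists i.
have hsum : forall b, (b <= B)%N ->
    b%:R * c <= \sum_(0 <= k < m0 * 2 ^ b) u k.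
  elim => [|b IH] bB.
    by rewrite mul0r big_nat sumr_ge0// => k _; case/andP: (u01 k).
  rewrite -natr1 mulrDl mul1r.
  rewrite (big_cat_nat _ (n := (m0 * 2 ^ b)%N))//=; last first.
    by rewrite leq_mul2l leq_exp2l// leqnSn orbT.
  rewrite lerD ?IH ?(ltnW bB)//.
  rewrite expnS mulnCA mul2n -addnn -{1}[(m0 * 2 ^ b)%N]add0n big_addn addnK.
  rewrite big_mkord (le_trans (hblock (Ordinal bB)))//=.
  by apply: ler_sum => j _; rewrite addnC.
have h := stick_left_le_expR (m0 * 2 ^ B) u01.
have := hsum B (leqnn _); rewrite -lerN2 -ler_expR; lra.
Qed.

(** Rounding each y i up to a power of rho costs at most a factor rho in the
    product, unless some y i is below rho ^ J, which is already small enough.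
    The finitely many exponents g turn an event about a product of independent
    variables into a finite union of intersections of one-variable events. *)
Lemma grid_cover n J (y : 'I_n -> R) (rho tau : R) : 0 < rho < 1 ->
  (forall i, 0 < y i <= 1) -> rho ^+ J <= tau -> \prod_i y i <= tau ->
  exists2 g : {ffun 'I_n -> 'I_J.+1}, (forall i, y i <= rho ^+ g i) &
    rho ^+ (\sum_i g i) * rho ^+ n <= tau.
Proof.
move=> /andP[r0 r1] y01 hJ hy.
have P0 i : y i <= rho ^+ (ord0 : 'I_J.+1).
  by rewrite expr0; case/andP: (y01 i).
pose below i := [pred j : 'I_J.+1 | y i <= rho ^+ j].
pose g := [ffun i => arg_max (ord0 : 'I_J.+1) (below i) (@nat_of_ord J.+1)].
have gP i : y i <= rho ^+ g i /\
    forall j : 'I_J.+1, y i <= rho ^+ j -> (j <= g i)%N.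
  rewrite ffunE; case: arg_maxnP; first exact: P0.
  by move=> j yj jmax; split.
exists g; first by move=> i; case: (gP i).
have rn1 k : rho ^+ k <= 1 by rewrite exprn_ile1// ltW.
have [[i gi]|hno] := pselect (exists i, g i = ord_max).
  have h1 : rho ^+ (\sum_i g i) <= rho ^+ J.
    rewrite ler_wiXn2l ?(ltW r0) ?(ltW r1)//.
    by rewrite (bigD1 i)//= gi leq_addr.
  by rewrite (le_trans _ hJ)// (le_trans _ h1)// ler_piMr ?exprn_ge0 ?(ltW r0).
have hlt i : rho ^+ (g i).+1 <= y i.
  have gJ : ((g i).+1 < J.+1)%N.
    rewrite ltnS ltn_neqAle -ltnS ltn_ord andbT.
    by apply/eqP => e; apply: hno; exists i; apply: val_inj.
  rewrite leNgt; apply/negP => /ltW yi.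
  by have [_ /(_ (Ordinal gJ) yi)] := gP i; rewrite /= ltnn.
apply: le_trans hy; rewrite -exprD.
have -> : (\sum_i g i + n = \sum_i (g i).+1)%N.
  under [RHS]eq_bigr do rewrite -addn1.
  by rewrite big_split/= sum1_card card_ord.
rewrite expr_sum; apply: ler_prod => i _; rewrite hlt andbT.
by rewrite exprn_ge0// ltW.
Qed.

End deterministic.

(** * Union bounds and finite independence *)

Section probability_tools.
Context {R : realType} {d : measure_display} {Omega : measurableType d}
  (P : probability Omega R).

Lemma le_measure_ae (A E : set Omega) : measurable A -> measurable E ->
  {ae P, forall w, A w -> E w} -> (P A <= P E)%E.
Proof.
move=> mA mE [N [mN N0 AN]].
apply: (@le_trans _ _ (P (E `|` N))).
  apply: le_measure; rewrite ?inE//; first exact: measurableU.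
  move=> w Aw; have [Ew|nEw] := pselect (E w); [by left|right].
  by apply: AN => /(_ Aw).
have PN0 : P N = 0%E by exact: N0.
by apply: le_trans (measureU2 P mE mN) _; rewrite [X in (_ + X)%E]PN0 adde0.
Qed.

Lemma union_bound (I : finType) (D : set I) (E : I -> set Omega) (c : R) :
  0 <= c -> (forall i, D i -> measurable (E i) /\ (P (E i) <= c%:E)%E) ->
  measurable (\bigcup_(i in D) E i) /\
  (P (\bigcup_(i in D) E i) <= (#|I|%:R * c)%:E)%E.
Proof.
move=> c0 Ec.
have -> : \bigcup_(i in D) E i = \big[setU/set0]_(i in [pred i | `[< D i >]]) E i.
  rewrite -bigcup_pred; apply: eq_bigcupl.
  split=> i h; first exact/asboolP.
  by move/asboolP: h.
suff [mE PE] : measurable (\big[setU/set0]_(i in [pred i | `[< D i >]]) E i) /\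
    (P (\big[setU/set0]_(i in [pred i | `[< D i >]]) E i) <=
      \sum_(i in [pred i | `[< D i >]]) c%:E)%E.
  split=> //; rewrite (le_trans PE)// sumEFin lee_fin sumr_const -[leLHS]mulr_natl.
  by rewrite ler_wpM2r// ler_nat max_card.
apply: (big_ind2 (fun A x => measurable A /\ (P A <= x)%E)).
- by rewrite measure0.
- move=> A x B y [mA Ax] [mB By]; split; first exact: measurableU.
  by rewrite (le_trans (measureU2 _ mA mB))// leeD.
- by move=> i; rewrite inE; exact: Ec.
Qed.

(** Independence is stated for finite sets of indices; here the indices are
    enumerated by an injective f, which is how they are produced below. *)
Lemma independent_injective (U : nat -> {RV P >-> R}) n (f : 'I_n -> nat)
    (A : 'I_n -> set R) : mutually_independent U -> injective f ->
  (forall i, measurable (A i)) ->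
  P (\bigcap_i (U (f i) @^-1` A i)) = (\prod_i P (U (f i) @^-1` A i))%E.
Proof.
move=> hU injf mA.
pose A' k := if [pick i | f i == k] is Some i then A i else setT.
have A'f i : A' (f i) = A i.
  rewrite /A'; case: pickP => [j /eqP /injf -> //|/(_ i)].
  by rewrite eqxx.
pose J := [fset k in [seq f i | i <- enum 'I_n]]%fset.
have mA' k : measurable (A' k) by rewrite /A'; case: pickP.
have := hU J A' mA'.
have -> : \bigcap_(k in [set` J]) (U k @^-1` A' k) = \bigcap_i (U (f i) @^-1` A i).
  apply/seteqP; split=> w h.
    move=> i _; rewrite -A'f; apply: h => /=.
    by rewrite !inE; apply/mapP; exists i; rewrite ?mem_enum.
  by move=> k /=; rewrite !inE => /mapP[i _ ->]; rewrite /= A'f; exact: h.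
move=> ->.
have -> : (\prod_(k <- J) P (U k @^-1` A' k) =
    \prod_(k <- [seq f i | i <- enum 'I_n]) P (U k @^-1` A' k))%E.
  apply: perm_big; apply: uniq_perm; first exact: fset_uniq.
    by rewrite map_inj_uniq ?enum_uniq.
  by move=> k; rewrite !inE.
by rewrite big_map big_enum/=; apply: eq_bigr => i _; rewrite A'f.
Qed.

Lemma independent_le (U : nat -> {RV P >-> R}) n (f : 'I_n -> nat)
    (A : 'I_n -> set R) (c : 'I_n -> R) : mutually_independent U -> injective f ->
  (forall i, measurable (A i)) -> (forall i, (P (U (f i) @^-1` A i) <= (c i)%:E)%E) ->
  measurable (\bigcap_i (U (f i) @^-1` A i)) /\
  (P (\bigcap_i (U (f i) @^-1` A i)) <= (\prod_i c i)%:E)%E.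
Proof.
move=> hU injf mA Ac; split.
  apply: fin_bigcap_measurable => [|i _]; first exact: finite_finset.
  exact: measurable_funPTI.
rewrite independent_injective//.
suff [] : (0 <= \prod_i P (U (f i) @^-1` A i) /\
  \prod_i P (U (f i) @^-1` A i) <= (\prod_i c i)%:E)%E by [].
apply: (big_ind2 (fun x y => 0 <= x /\ x <= y%:E)%E).
- by [].
- move=> x r y s [x0 xr] [y0 ys]; rewrite EFinM mule_ge0//; split=> //.
  exact: lee_pmul.
- by move=> i _; split.
Qed.

(** Union bound over the at most 2 ^ M subsets of size at least M / 2: for each
    of them, all its variables lie below t with probability at most
    (1 / 16) ^ (M / 2). *)
Lemma half_below_probability (U : nat -> {RV P >-> R}) m M (t : R) :
  mutually_independent U ->
  (forall i, (i < M)%N -> (P (U (m + i)%N @^-1` `]-oo, t[) <= (16^-1)%:E)%E) ->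
  exists E : set Omega, [/\ measurable E, (P E <= ((2^-1) ^+ M)%:E)%E &
    forall w (S : {set 'I_M}), (M <= 2 * #|S|)%N ->
      (forall i, i \in S -> U (m + i)%N w < t) -> E w].
Proof.
move=> hU ht.
pose D : set {set 'I_M} := [set S : {set 'I_M} | (M <= 2 * #|S|)%N].
pose A (S : {set 'I_M}) (i : 'I_M) : set R :=
  if i \in S then `]-oo, t[%classic else setT.
pose E S := \bigcap_(i : 'I_M) (U (m + i)%N @^-1` A S i).
have injm : injective (fun i : 'I_M => (m + i)%N) by move=> i j /addnI /val_inj.
have [mE PE] : measurable (\bigcup_(S in D) E S) /\
    (P (\bigcup_(S in D) E S) <= (#|{set 'I_M}|%:R * (4^-1) ^+ M)%:E)%E.
  apply: union_bound => [|S DS]; first by rewrite exprn_ge0.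
  pose c i := if i \in S then 16^-1 else 1 : R.
  have [||mES PES] := @independent_le U M _ (A S) c hU injm.
  - by move=> i; rewrite /A; case: ifP.
  - move=> i; rewrite /A /c; case: ifP => _; first exact: ht.
    by rewrite preimage_setT probability_setT.
  split=> //; rewrite (le_trans PES)// lee_fin /c -big_mkcond/= prodr_const.
  have -> : 16^-1 = (4^-1) ^+ 2 :> R by field.
  by rewrite -exprM ler_wiXn2l ?invr_ge0 ?invf_le1 ?ler1n.
exists (\bigcup_(S in D) E S); split=> //.
  rewrite (le_trans PE)// lee_fin -cardsT -powersetT card_powerset cardsT card_ord.
  rewrite natrX -exprMn.
  by rewrite (_ : 2%:R / 4 = 2^-1)//; field.
move=> w S DS hS; exists S => // i _; rewrite /= /A; case: ifP => // iS.
by rewrite /= in_itv/= hS.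
Qed.

End probability_tools.

(** * The exponential upper bound *)

Section upper_fixed.
Context {R : realType} {d : measure_display} {Omega : measurableType d}
  (P : probability Omega R) (U : nat -> {RV P >-> R}) (theta alpha : R).
Implicit Types (w : Omega) (n m N K B J : nat).

Definition beta_sticks := 
  forall k, has_beta_distribution (U k) (1 - alpha) (theta + k.+1%:R * alpha).

Lemma beta_sticks_gt1 k : 0 < alpha -> 1 <= theta ->
  1 < theta + k.+1%:R * alpha.
Proof.
move=> a0 t1; rewrite (le_lt_trans t1)// ltrDl mulr_gt0//.
Qed.

(** In the block [m, 2m), m = m0 2 ^ i >= theta, the second parameter of the beta
    law is at most 3m, and kappa is chosen so that each break is below
    kappa / (3m) with probability at most 1 / 16.  The block sums to less than
    kappa / 6 only if half of its breaks are that small. *)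
Lemma stick_left_probability m0 B (kappa delta : R) :
  0 < alpha < 1 -> 1 <= theta -> mutually_independent U -> beta_sticks ->
  theta <= m0%:R -> 0 < kappa <= 1 -> expR 1 * kappa `^ (1 - alpha) = 16^-1 ->
  expR (- (B%:R * (kappa / 6))) < delta ->
  exists E : set Omega, [/\ measurable E, (P E <= (B%:R * 2^-1 ^+ m0)%:E)%E &
    forall w, (forall k, 0 <= U k w <= 1) ->
      delta <= stick_left (fun k => U k w) (m0 * 2 ^ B) -> E w].
Proof.
move=> /andP[a0 a1] t1 hU hb tm0 /andP[k0 k1] hk hB.
have m00 : (0 < m0)%N by rewrite -(ltr_nat R); lra.
have hE (i : 'I_B) : exists E : set Omega, [/\ measurable E,
    (P E <= ((2^-1) ^+ (m0 * 2 ^ i))%:E)%E &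
    forall w (S : {set 'I_(m0 * 2 ^ i)}), (m0 * 2 ^ i <= 2 * #|S|)%N ->
      (forall j, j \in S ->
        U (m0 * 2 ^ i + j)%N w < 2 * (kappa / 6) / (m0 * 2 ^ i)%:R) -> E w].
  apply: half_below_probability => // j jm.
  set m := (m0 * 2 ^ i)%N in jm *.
  have m0m : (m0 <= m)%N by rewrite /m leq_pmulr// expn_gt0.
  have tm : theta <= m%:R by rewrite (le_trans tm0)// ler_nat.
  have m0' : 0 < m%:R :> R by lra.
  set b := theta + (m + j).+1%:R * alpha.
  have b1 : 1 < b by exact: beta_sticks_gt1.
  have b3 : b <= 3 * m%:R.
    have h : (m + j).+1%:R <= 2 * m%:R :> R.
      by rewrite -natrM ler_nat mul2n -addnn -addnS leq_add2l.
    have : (m + j).+1%:R * alpha <= (m + j).+1%:R by rewrite ler_piMr// ltW.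
    rewrite /b; lra.
  have te : 2 * (kappa / 6) / m%:R = kappa / (3 * m%:R).
    by field; rewrite gt_eqF.
  rewrite te.
  have m3 : 0 < 3 * m%:R :> R by rewrite mulr_gt0.
  have tk : 0 < kappa / (3 * m%:R) <= 1.
    by rewrite divr_gt0//= ler_pdivrMr// mul1r; lra.
  apply: le_trans (@beta_lower_tail _ _ _ _ _ _ _ _ _ b1 (hb _) tk) _; first lra.
  rewrite lee_fin -hk ler_wpM2l ?expR_ge0//; apply: ler_powR_base; first lra.
    by rewrite mulr_ge0//; [lra|case/andP: tk => /ltW].
  by rewrite mulrA ler_pdivrMr// mulrC ler_wpM2l// ltW.
have [E EP] := choice hE.
have [mE PE] : measurable (\bigcup_(i in [set: 'I_B]) E i) /\
    (P (\bigcup_(i in [set: 'I_B]) E i) <= (#|'I_B|%:R * 2^-1 ^+ m0)%:E)%E.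
  apply: union_bound => [|i _]; first by rewrite exprn_ge0.
  have [mEi PEi _] := EP i; split=> //; rewrite (le_trans PEi)// lee_fin.
  by rewrite ler_wiXn2l ?invr_ge0 ?invf_le1 ?ler1n// leq_pmulr// expn_gt0.
exists (\bigcup_(i in [set: 'I_B]) E i); rewrite card_ord in PE; split=> //.
move=> w u01 hd; have [i hi] := light_block u01 hB hd.
have [_ _ hEi] := EP i; exists i => //.
have m00' : (0 < m0 * 2 ^ i)%N by rewrite muln_gt0 m00 expn_gt0.
have u0 k : 0 <= U k w by case/andP: (u01 k).
have [S hS hSu] := half_below u0 m00' hi.
exact: hEi hS hSu.
Qed.

Lemma exprn_powR (x : R) j (t : R) : 0 <= x -> (x ^+ j) `^ t = (x `^ t) ^+ j.
Proof.
move=> x0; rewrite -powR_mulrn// -powRrM mulrC powRrM powR_mulrn//.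
exact: powR_ge0.
Qed.

(** Union bound over the indices f and the grid exponents g of grid_cover.  Each
    term is a product of n one-variable tails, whose powers of rho recombine. *)
Lemma small_product_probability n K J (D rho tau : R) :
  mutually_independent U -> 0 < rho < 1 -> 0 <= D -> 0 <= theta ->
  rho ^+ J <= tau ->
  (forall k j, (k < K)%N ->
    (P (U k @^-1` `[(1 - rho ^+ j)%R, +oo[) <= (D * (rho ^+ j) `^ theta)%:E)%E) ->
  exists E : set Omega, [/\ measurable E,
    (P E <= ((K ^ n * J.+1 ^ n)%:R * (D ^+ n * (tau / rho ^+ n) `^ theta))%:E)%E &
    forall w (f : {ffun 'I_n -> 'I_K}), (forall k, 0 <= U k w < 1) ->
      injective f -> \prod_(i < n) (1 - U (f i) w) <= tau -> E w].
Proof.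
move=> hU r01 D0 t0 hJ htail; case/andP: (r01) => r0 r1.
have rn0 k : 0 < rho ^+ k by rewrite exprn_gt0.
pose I := ({ffun 'I_n -> 'I_K} * {ffun 'I_n -> 'I_J.+1})%type.
pose admissible : set I :=
  [set fg : I | injective fg.1 /\ rho ^+ (\sum_i fg.2 i) * rho ^+ n <= tau].
pose A (fg : I) (i : 'I_n) : set R := `[(1 - rho ^+ fg.2 i)%R, +oo[%classic.
pose E (fg : I) := \bigcap_(i : 'I_n) (U (fg.1 i) @^-1` A fg i).
have [mE PE] : measurable (\bigcup_(fg in admissible) E fg) /\
    (P (\bigcup_(fg in admissible) E fg) <=
       (#|{: I}|%:R * (D ^+ n * (tau / rho ^+ n) `^ theta))%:E)%E.
  apply: union_bound => [|fg [injf hg]].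
    by rewrite mulr_ge0 ?exprn_ge0 ?powR_ge0.
  pose c i := D * (rho ^+ fg.2 i) `^ theta.
  have [|||mEf PEf] := @independent_le _ _ _ P U n (fun i => fg.1 i) (A fg) c hU.
  - by move=> i j /val_inj; exact: injf.
  - by move=> i; exact: measurable_itv.
  - by move=> i; apply: htail; exact: ltn_ord.
  split=> //; rewrite (le_trans PEf)// lee_fin /c big_split/= prodr_const card_ord.
  rewrite ler_wpM2l ?exprn_ge0//.
  under eq_bigr do rewrite exprn_powR ?(ltW r0)//.
  rewrite -expr_sum -exprn_powR ?(ltW r0)//.
  by apply: ler_powR_base; rewrite ?(ltW (rn0 _))// ler_pdivlMr.
exists (\bigcup_(fg in admissible) E fg); split=> //.
  by move: PE; rewrite card_prod !card_ffun !card_ord.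
move=> w f u01 injf hf.
have y01 (i : 'I_n) : 0 < 1 - U (f i) w <= 1.
  by have /andP[? ?] := u01 (f i); apply/andP; split; lra.
have [g gy gtau] := grid_cover r01 y01 hJ hf.
exists (f, g) => //= i _; rewrite /= /A/= in_itv/= andbT.
by have := gy i; lra.
Qed.

(** The factor of (rho ^ j) ^ theta in the bound of beta_upper_tail at
    y = rho ^ j, made uniform over j >= 1 and over the first K breaks. *)
Definition tail_constant (K : nat) (rho eta : R) : R :=
  (1 - rho) `^ (- alpha) / eta * (1 - eta)^-1 `^ (theta + K%:R * alpha).

Lemma tail_constant_ge1 K (rho eta : R) : 0 < alpha -> 0 <= theta ->
  0 < rho < 1 -> 0 < eta < 1 -> 1 <= tail_constant K rho eta.
Proof.
move=> a0 t0 /andP[r0 r1] /andP[e0 e1]; rewrite /tail_constant.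
have h1 : 1 <= (1 - rho) `^ (- alpha) by apply: powR_inv_ge1; lra.
have h2 : 1 <= (1 - eta)^-1 `^ (theta + K%:R * alpha).
  rewrite powRVl; last lra.
  rewrite -powRN; apply: powR_inv_ge1; first lra.
  by rewrite oppr_le0 addr_ge0// mulr_ge0// ltW.
have h3 : 1 <= eta^-1 by rewrite invf_ge1// ltW.
by rewrite mulr_ege1// mulr_ege1.
Qed.

Lemma beta_sticks_tail K (rho eta : R) : 0 < alpha < 1 -> 1 <= theta ->
  beta_sticks -> 0 < rho < 1 -> 0 < eta < 1 -> forall k j, (k < K)%N ->
  (P (U k @^-1` `[(1 - rho ^+ j)%R, +oo[) <=
    (tail_constant K rho eta * (rho ^+ j) `^ theta)%:E)%E.
Proof.
move=> /andP[a0 a1] t1 hb r01 e01 k j kK.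
have C1 := @tail_constant_ge1 K rho eta a0 (le_trans ler01 t1) r01 e01.
case: j => [|j].
  rewrite expr0 powR1 mulr1.
  apply: (@le_trans _ _ 1%:E); last by rewrite lee_fin.
  by apply: probability_le1; exact: measurable_funPTI.
move: (r01) (e01) => /andP[r0 r1] /andP[e0 e1].
have y0 : 0 < rho ^+ j.+1 by rewrite exprn_gt0.
have yr : rho ^+ j.+1 <= rho.
  by rewrite exprS ler_piMr ?exprn_ile1// ltW.
have b1 := @beta_sticks_gt1 k a0 t1.
set b := theta + _ in b1.
apply: le_trans (@beta_upper_tail _ _ _ _ _ _ _ _ _ _ b1 (hb k) _ e01) _.
- by lra.
- by rewrite y0 (le_lt_trans yr).
rewrite lee_fin powRM ?invr_ge0 ?(ltW y0)//; last lra.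
rewrite [X in X <= _](_ : _ = (1 - rho ^+ j.+1) `^ (1 - alpha - 1) / eta *
   ((1 - eta)^-1 `^ b) * (rho ^+ j.+1) `^ b); last by ring.
have h1 : (rho ^+ j.+1) `^ b <= (rho ^+ j.+1) `^ theta.
  apply: ger_powR; first by rewrite y0 (le_trans yr)// ltW.
  by rewrite /b lerDl mulr_ge0// ltW.
have h2 : (1 - eta)^-1 `^ b <= (1 - eta)^-1 `^ (theta + K%:R * alpha).
  apply: ler_powR; first by rewrite invf_ge1; lra.
  by rewrite /b lerD2l ler_wpM2r ?(ltW a0)// ler_nat.
have h3 : (1 - rho ^+ j.+1) `^ (1 - alpha - 1) <= (1 - rho) `^ (- alpha).
  rewrite (_ : 1 - alpha - 1 = - alpha); last by ring.
  rewrite !powRN lef_pV2 ?posrE ?powR_gt0//; try lra.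
  by apply: ler_powR_base; lra.
rewrite /tail_constant ler_pM ?mulr_ge0 ?powR_ge0 ?invr_ge0 ?(ltW e0)//.
rewrite ler_pM ?mulr_ge0 ?powR_ge0 ?invr_ge0 ?(ltW e0)//.
by rewrite ler_wpM2r// invr_ge0 ltW.
Qed.

End upper_fixed.

Section exponential_scale.
Context {R : realType}.

(** With s = ln (c / q) / (n + 1), (c / q) ^ theta is the (n + 1)-st power of
    exp (s theta) >= s theta, which outgrows A theta ^ n. *)
Lemma absorb_polynomial (q c A : R) n : 0 < q < c -> 0 <= A ->
  \forall theta \near +oo, A * theta ^+ n * q `^ theta <= c `^ theta.
Proof.
move=> /andP[q0 qc] A0.
have c0 : 0 < c by exact: lt_trans qc.
have n1 : n.+1%:R != 0 :> R by rewrite pnatr_eq0.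
pose s : R := ln (c / q) / n.+1%:R.
have s0 : 0 < s.
  by rewrite divr_gt0// ln_gt0// ltr_pdivlMr// mul1r.
near=> theta.
have t0 : 0 <= theta by near: theta; apply: nbhs_pinfty_ge; exact: num_real.
have tA : A / s ^+ n.+1 <= theta by near: theta; apply: nbhs_pinfty_ge; exact: num_real.
rewrite ler_pdivrMr ?exprn_gt0// in tA.
have -> : c `^ theta = (c / q) `^ theta * q `^ theta.
  by rewrite -powRM ?divfK ?gt_eqF// ?divr_ge0// ltW.
rewrite ler_wpM2r ?powR_ge0//.
have -> : (c / q) `^ theta = expR (s * theta) ^+ n.+1.
  rewrite -expRM_natl /powR gt_eqF ?divr_gt0//; congr expR.
  by rewrite /s; field.
apply: (@le_trans _ _ ((s * theta) ^+ n.+1)); last first.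
  have st0 : 0 <= s * theta by rewrite mulr_ge0// ltW.
  apply: lerXn2r; rewrite ?nnegrE ?expR_ge0//.
  by rewrite (le_trans _ (expR_ge1Dx _))// lerDr.
have -> : (s * theta) ^+ n.+1 = theta * s ^+ n.+1 * theta ^+ n.
  by rewrite exprMn (exprS theta); ring.
by rewrite ler_wpM2r ?exprn_ge0.
Unshelve. all: by end_near. Qed.

Lemma exists_expr_lt (rho t : R) : 0 < rho < 1 -> 0 < t ->
  exists J : nat, rho ^+ J < t.
Proof.
move=> /andP[r0 r1] t0.
have : rho ^+ n @[n --> \oo] --> 0 by apply: cvg_expr; rewrite ger0_norm ?ltW.
move/cvgrPdist_lt => /(_ t t0) [J _ hJ]; exists J.
have := hJ J (leqnn J); rewrite sub0r normrN ger0_norm// exprn_ge0//.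
exact: ltW.
Qed.

Lemma exists_base_near1 (x y M : R) : 0 < x < y -> 0 <= M ->
  exists2 rho, 0 < rho < 1 & x <= y * rho `^ M.
Proof.
move=> /andP[x0 xy] M0; have y0 : 0 < y by exact: lt_trans xy.
have xy0 : 0 < x / y by rewrite divr_gt0.
have xy1 : x / y < 1 by rewrite ltr_pdivrMr// mul1r.
have M1 : 0 < M + 1 by lra.
have r0 : 0 < (x / y) `^ (M + 1)^-1 by rewrite powR_gt0.
have r1 : (x / y) `^ (M + 1)^-1 < 1.
  have := gt0_ltr_powR (r := (M + 1)^-1).
  rewrite invr_gt0 => /(_ M1 (x / y) 1); rewrite powR1 !nnegrE; apply=> //.
  exact: ltW.
exists ((x / y) `^ (M + 1)^-1); first by rewrite r0.
rewrite mulrC -ler_pdivrMr// -powRrM.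
rewrite -[leLHS]powRr1 ?(ltW xy0)//; apply: ger_powR; first by rewrite xy0 ltW.
by rewrite mulrC ler_pdivrMr// mul1r lerDl.
Qed.

End exponential_scale.

Section upper_bound.
Context {R : realType}.

(** Almost surely the n largest pieces exceed sigma only if delta is left after
    N = m0 2 ^ B breaks or, by top_pieces and sum_stick_breaking_le, n of the
    variables 1 - U k, k < K, have product at most 1 - sigma + delta. *)
Lemma poisson_dirichlet_upper_fixed (theta alpha : R)
    (Q : probability (borel (nabla R)) R) (F : set (borel (nabla R)))
    (n m0 B J K : nat) (kappa sigma delta rho eta : R) :
  0 < alpha < 1 -> 1 <= theta -> is_poisson_dirichlet theta alpha Q ->
  measurable F -> (forall p : nabla R, F p -> sigma < \sum_(i < n) p i) ->
  theta <= m0%:R -> 0 < kappa <= 1 -> expR 1 * kappa `^ (1 - alpha) = 16^-1 ->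
  expR (- (B%:R * (kappa / 6))) < delta ->
  0 < rho < 1 -> 0 < eta < 1 -> rho ^+ J <= 1 - sigma + delta ->
  K = (m0 * 2 ^ B + n)%N ->
  (Q F <= (B%:R * 2^-1 ^+ m0 + (K ^ n * J.+1 ^ n)%:R *
     (tail_constant theta alpha K rho eta ^+ n *
        ((1 - sigma + delta) / rho ^+ n) `^ theta))%:E)%E.
Proof.
move=> a01 t1 hPD mF hF tm0 k01 hk hB r01 e01 hJ KE.
case: hPD => d' [T [P [U [V [hU hb hV hQ]]]]].
have t0 : 0 <= theta by rewrite (le_trans ler01).
have [E1 [mE1 PE1 hE1]] := stick_left_probability a01 t1 hU hb tm0 k01 hk hB.
have C0 : 0 <= tail_constant theta alpha K rho eta.
  apply: (@le_trans _ _ 1) => //; case/andP: a01 => a0 _.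
  exact: tail_constant_ge1.
have [E2 [mE2 PE2 hE2]] := @small_product_probability _ _ _ P U theta n K J _ rho _
  hU r01 C0 t0 hJ (beta_sticks_tail a01 t1 hb r01 e01).
rewrite KE in hE2.
rewrite hQ//; apply: (@le_trans _ _ (P (E1 `|` E2))); last first.
  by rewrite (le_trans (measureU2 P mE1 mE2))// EFinD leeD.
rewrite -[leLHS]/(P (V @^-1` F)).
apply: le_measure_ae; [exact: measurable_funPTI|exact: measurableU|].
have hU01 : {ae P, forall w, forall k, U k w \in `]0, 1[}.
  apply/ae_foralln => k; exists (U k @^-1` ~` `]0%R, 1%R[); split.
  - by apply: measurable_funPTI; exact: measurableC.
  - exact: (beta_as01 (hb k)).
  - by move=> w /= h h'; apply: h.
apply: filterS2 hU01 hV => w u01 [_ [s bs Vs]] Fw.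
have u01' k : 0 < U k w < 1 by have := u01 k; rewrite in_itv.
have u01'' k : 0 <= U k w <= 1 by have /andP[/ltW-> /ltW->] := u01' k.
have [hl|hl] := leP delta (stick_left (fun k => U k w) (m0 * 2 ^ B)).
  by left; exact: hE1.
have injs : injective s by exact: bij_inj.
have hsum : sigma < \sum_(i < n) stick_breaking (fun k => U k w) (s i).
  by have := hF _ Fw; under eq_bigr do rewrite Vs.
have [f injf hf] := top_pieces u01'' injs hsum hl.
right; apply: (hE2 w f) => //; last exact: ltW.
by move=> k; have /andP[/ltW-> ->] := u01' k.
Qed.

Lemma ler_add_halves (x y x' y' z : R) : x <= x' -> y <= y' ->
  2 * x' <= z -> 2 * y' <= z -> x + y <= z.
Proof. by lra. Qed.

(** B, C, rho, J and eta are chosen in this order, each depending only on the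
    previous ones; the number N = C t 2 ^ B of breaks is then linear in theta, so
    that the number of choices of indices is polynomial in theta and the constant
    (1 - eta) ^ (- (theta + K alpha) n) stays exponential with a rate that a
    small eta makes negligible. *)
Lemma poisson_dirichlet_upper (alpha sigma c : R) n : 0 < alpha < 1 ->
  0 < 1 - sigma < c -> c < 1 ->
  \forall theta \near +oo, forall Q : probability (borel (nabla R)) R,
    is_poisson_dirichlet theta alpha Q ->
    forall F : set (borel (nabla R)), measurable F ->
      (forall p : nabla R, F p -> sigma < \sum_(i < n) p i) ->
      (Q F <= (c `^ theta)%:E)%E.
Proof.
move=> a01 /andP[s0 sc] c1; case/andP: (a01) => a0 a1.
(* The slack between 1 - sigma and c is spent in three steps: tau absorbs the
   stick left after N breaks, q the grid and q' the normalising constants. *)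
pose delta : R := (c - (1 - sigma)) / 4.
pose tau : R := 1 - sigma + delta.
pose q : R := tau + delta.
pose q' : R := q + delta.
have d0 : 0 < delta by rewrite /delta; lra.
have tau0 : 0 < tau by rewrite /tau; lra.
have qc : q' < c by rewrite /q' /q /tau /delta; lra.
pose kappa : R := (expR (- 1) / 16) `^ (1 - alpha)^-1.
have e16 : 0 < (expR (- 1) / 16 : R) < 1.
  have : expR (- 1) < 1 :> R by rewrite expR_lt1; lra.
  by rewrite divr_gt0 ?expR_gt0//= ltr_pdivrMr// mul1r => ?; lra.
have k01 : 0 < kappa <= 1.
  rewrite powR_gt0; last by case/andP: e16.
  by apply: powR_le1; [rewrite invr_ge0; lra|case/andP: e16 => /ltW-> /ltW->].
have hk : expR 1 * kappa `^ (1 - alpha) = 16^-1.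
  have a1n : 1 - alpha != 0 by rewrite gt_eqF//; lra.
  have e16' : 0 <= (expR (- 1) / 16 : R) by case/andP: e16 => /ltW.
  rewrite /kappa -powRrM mulVf// powRr1//.
  by rewrite mulrA -expRD addrN expR0 mul1r.
have [B hB] : exists B : nat, expR (- (B%:R * (kappa / 6))) < delta.
  have h6 : 0 < expR (- (kappa / 6)) < 1.
    by rewrite expR_gt0 expR_lt1; case/andP: k01 => *; lra.
  have [B hB] := exists_expr_lt h6 d0; exists B.
  by rewrite -mulrN expRM_natl.
have c0 : 0 < c by lra.
have c20 : 0 < c / 2 by lra.
have c21 : c / 2 < 1 by lra.
have [C hC] : exists C : nat, 2^-1 ^+ C < c / 2 :> R.
  by apply: exists_expr_lt => //; lra.
have [rho r01 hrho] : exists2 rho : R, 0 < rho < 1 & tau <= q * rho `^ n%:R.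
  by apply: exists_base_near1 => //; rewrite tau0 /q; lra.
case/andP: (r01) => r0 r1.
rewrite powR_mulrn ?(ltW r0)// in hrho.
have [J hJ] := exists_expr_lt r01 tau0.
pose L : R := (C * 2 ^ B.+1 + n)%:R.
have L0 : 0 <= L by rewrite ler0n.
have q0 : 0 < q by rewrite /q; lra.
have [x x01 hx] : exists2 x : R, 0 < x < 1 & q <= q' * x `^ ((1 + L) * n%:R).
  apply: exists_base_near1; last by rewrite mulr_ge0// addr_ge0.
  by rewrite q0 /q'; lra.
pose eta : R := 1 - x.
have e01 : 0 < eta < 1 by rewrite /eta; case/andP: x01 => *; lra.
pose C0 := (1 - rho) `^ (- alpha) / eta.
have C00 : 0 <= C0 by rewrite divr_ge0 ?powR_ge0//; case/andP: e01 => /ltW.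
have A0 : 0 <= 2 * ((L * J.+1%:R) ^+ n * C0 ^+ n).
  by rewrite mulr_ge0// mulr_ge0// exprn_ge0// mulr_ge0.
near=> theta => Q hQ F mF hF.
have t1 : 1 <= theta by near: theta; apply: nbhs_pinfty_ge; exact: num_real.
have t0 : 0 <= theta by rewrite (le_trans ler01).
pose t := (Num.truncn theta).+1.
have /andP[t_le t_gt] := truncn_itv t0.
have tt : t%:R <= 2 * theta :> R by rewrite /t -natr1 mulr_natl mulr2n lerD.
have C1 : (0 < C)%N.
  by rewrite lt0n; apply: contraL (ltW hC) => /eqP->; rewrite expr0 -ltNge.
pose m0 := (C * t)%N.
have tm0 : theta <= m0%:R.
  by rewrite (le_trans (ltW t_gt))// ler_nat leq_pmull.
pose K := (m0 * 2 ^ B + n)%N.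
have := @poisson_dirichlet_upper_fixed theta alpha Q F n m0 B J K kappa sigma delta
  rho eta a01 t1 hQ mF hF tm0 k01 hk hB r01 e01 (ltW hJ) erefl.
move=> /le_trans; apply; rewrite lee_fin.
have KL : K%:R <= L * theta.
  rewrite /K /L /m0 !natrD !natrM !natrX mulrDl exprS.
  rewrite lerD ?ler_peMr//.
  have -> : C%:R * (2 * 2 ^+ B) * theta = (2 * theta) * (C%:R * 2 ^+ B) :> R by ring.
  rewrite (_ : C%:R * t%:R * 2 ^+ B = t%:R * (C%:R * 2 ^+ B)); last by ring.
  by rewrite ler_wpM2r// mulr_ge0// exprn_ge0.
have h1 : B%:R * 2^-1 ^+ m0 <= B%:R * (c / 2) `^ theta.
  rewrite ler_wpM2l// /m0 exprM.
  apply: (@le_trans _ _ ((c / 2) ^+ t)).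
    by rewrite lerXn2r ?nnegrE ?exprn_ge0 ?(ltW hC) ?(ltW c20).
  rewrite -powR_mulrn ?(ltW c20)//.
  by apply: ger_powR; [rewrite c20 ltW|exact: ltW].
have h2 : tail_constant theta alpha K rho eta <=
    C0 * (x^-1 `^ (1 + L)) `^ theta.
  rewrite /tail_constant -/C0 ler_wpM2l// /eta subKr -powRrM.
  apply: ler_powR; first by case/andP: x01 => x0 x1; rewrite invf_ge1 ?(ltW x1).
  by rewrite mulrDl mul1r lerD2l (le_trans _ KL)// ler_piMr// ltW.
have h3 : (tau / rho ^+ n) `^ theta <= q `^ theta.
  by apply: ler_powR_base; rewrite ?divr_ge0 ?exprn_ge0 ?ler_pdivrMr ?exprn_gt0// ltW.
have Tpos : 0 <= tail_constant theta alpha K rho eta.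
  by rewrite (le_trans ler01)// tail_constant_ge1.
have h4 : tail_constant theta alpha K rho eta ^+ n * (tau / rho ^+ n) `^ theta <=
    C0 ^+ n * q' `^ theta.
  apply: (@le_trans _ _ ((C0 * (x^-1 `^ (1 + L)) `^ theta) ^+ n * q `^ theta)).
    by rewrite ler_pM ?exprn_ge0 ?powR_ge0// lerXn2r ?nnegrE// (le_trans Tpos).
  rewrite exprMn -mulrA ler_wpM2l ?exprn_ge0//.
  rewrite -exprn_powR ?powR_ge0// -powRM ?exprn_ge0 ?powR_ge0 ?(ltW q0)//.
  apply: ler_powR_base => //.
    by rewrite mulr_ge0 ?exprn_ge0 ?powR_ge0// ltW.
  have x0 : 0 < x by case/andP: x01.
  rewrite -powR_mulrn ?powR_ge0// -powRrM powRVl ?(ltW x0)//.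
  by rewrite mulrC ler_pdivrMr ?powR_gt0.
have h5 : (K ^ n * J.+1 ^ n)%:R <= (L * J.+1%:R) ^+ n * theta ^+ n.
  rewrite natrM !natrX -!exprMn lerXn2r ?nnegrE ?mulr_ge0//.
  by rewrite mulrAC ler_wpM2r.
have h6 : 2 * B%:R * theta ^+ 0 * (c / 2) `^ theta <= c `^ theta.
  near: theta; apply: absorb_polynomial; last by rewrite mulr_ge0.
  by rewrite c20 gtr_pMr// invf_lt1// ltr1n.
have h7 : 2 * ((L * J.+1%:R) ^+ n * C0 ^+ n) * theta ^+ n * q' `^ theta <= c `^ theta.
  near: theta; apply: absorb_polynomial => //.
  by rewrite qc andbT /q'; lra.
have h8 : (K ^ n * J.+1 ^ n)%:R * (tail_constant theta alpha K rho eta ^+ n *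
   (tau / rho ^+ n) `^ theta) <=
   (L * J.+1%:R) ^+ n * theta ^+ n * (C0 ^+ n * q' `^ theta).
  by rewrite ler_pM// ?mulr_ge0 ?exprn_ge0 ?powR_ge0.
rewrite -/tau.
rewrite expr0 mulr1 in h6.
have e7 : 2 * ((L * J.+1%:R) ^+ n * C0 ^+ n) * theta ^+ n * q' `^ theta =
  2 * ((L * J.+1%:R) ^+ n * theta ^+ n * (C0 ^+ n * q' `^ theta)) by ring.
rewrite e7 in h7; rewrite -mulrA in h6.
exact: ler_add_halves h1 h8 h6 h7.
Unshelve. all: by end_near. Qed.

End upper_bound.

(** * Topology of the space of ranked sequences *)

Section nabla_topology.
Context {R : realType}.
Implicit Types p q : nabla R.

Lemma nabla_sum_fin p : (\sum_(i <oo) (p i)%:E)%E \is a fin_num.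
Proof.
rewrite ge0_fin_numE; first by rewrite (le_lt_trans (nabla_sum_le1 p))// ltry.
by apply: nneseries_ge0 => i _ _; rewrite lee_fin nabla_ge0.
Qed.

Lemma partial_sum_le p n : \sum_(i < n) p i <= nabla_sum p.
Proof.
rewrite -lee_fin /nabla_sum fineK ?nabla_sum_fin// -sumEFin.
have := @nneseries_lim_ge R (fun i => (p i)%:E) xpredT 0 n.
by rewrite big_mkord; apply => i _ _; rewrite lee_fin nabla_ge0.
Qed.

Lemma partial_sum_gt p (s : R) : s < nabla_sum p ->
  exists n, s < \sum_(i < n) p i.
Proof.
move=> sp; apply: contrapT => h; move: sp; apply/negP; rewrite -leNgt.
rewrite -lee_fin /nabla_sum fineK ?nabla_sum_fin//.
apply: lime_le.
  by apply: is_cvg_nneseries => i _ _; rewrite lee_fin nabla_ge0.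
near=> n; rewrite big_mkord sumEFin lee_fin leNgt; apply/negP => hn.
by apply: h; exists n.
Unshelve. all: by end_near. Qed.

Lemma nabla_sum_le p : nabla_sum p <= 1.
Proof. by rewrite -lee_fin /nabla_sum fineK ?nabla_sum_fin ?nabla_sum_le1. Qed.

Lemma nabla_le1 p i : p i <= 1.
Proof.
rewrite (le_trans _ (nabla_sum_le p))// (le_trans _ (partial_sum_le p i.+1))//.
by rewrite big_ord_recr/= lerDr sumr_ge0// => j _; exact: nabla_ge0.
Qed.

Let dist_term_ge0 p q i : (0 <= (`|p i - q i| / 2 ^+ i.+1)%:E)%E.
Proof. by rewrite lee_fin divr_ge0. Qed.

(** The coordinates from M on contribute at most the sum of the remaining
    weights, all coordinates being in [0, 1]. *)
Lemma nabla_dist_series_le p q (M : nat) (e : R) : 0 <= e ->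
  (forall i, (i < M)%N -> `|p i - q i| <= e) ->
  (\sum_(i <oo) (`|p i - q i| / 2 ^+ i.+1)%:E <= (e + 2^-1 ^+ M)%:E)%E.
Proof.
move=> e0 he.
have h m : \sum_(i < m) `|p i - q i| / 2 ^+ i.+1 <=
    e * (1 - 2^-1 ^+ m) + (if (m <= M)%N then 0 else 2^-1 ^+ M - 2^-1 ^+ m).
  elim: m => [|m IH]; first by rewrite big_ord0 expr0 subrr mulr0 addr0.
  have h0 : 0 < 2^-1 ^+ m.+1 :> R by rewrite exprn_gt0.
  have hm : 2^-1 ^+ m = 2 * 2^-1 ^+ m.+1 :> R by rewrite exprS; field.
  rewrite big_ord_recr/= -exprVn; rewrite hm in IH.
  have [mM|Mm] := ltnP m M.
    rewrite (ltnW mM) in IH.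
    have := ler_wpM2r (ltW h0) (he _ mM).
    move: IH; rewrite !mulrBr mulr1 !(mulrCA e); lra.
  have hn : `|p m - q m| <= 1.
    by have := nabla_ge0 p m; have := nabla_le1 p m; have := nabla_ge0 q m;
      have := nabla_le1 q m; rewrite ler_norml => *; apply/andP; split; lra.
  have := ler_wpM2r (ltW h0) hn; have eh := mulr_ge0 e0 (ltW h0).
  case: ltnP IH Mm => [Mm IH _|mM IH Mm].
    by move: IH; rewrite !mulrBr mulr1 !(mulrCA e); lra.
  have -> : M = m by apply/eqP; rewrite eqn_leq Mm mM.
  rewrite hm; move: IH; rewrite !mulrBr mulr1 !(mulrCA e); lra.
apply: lime_le; first by apply: is_cvg_nneseries => i _ _; exact: dist_term_ge0.
apply: nearW => m; rewrite big_mkord sumEFin lee_fin (le_trans (h m))//.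
have h0 : 0 < 2^-1 ^+ m :> R by rewrite exprn_gt0.
have h1 : 0 < 2^-1 ^+ M :> R by rewrite exprn_gt0.
have := mulr_ge0 e0 (ltW h0).
by case: ifP => _; lra.
Qed.

Lemma nabla_dist_fin p q :
  (\sum_(i <oo) (`|p i - q i| / 2 ^+ i.+1)%:E)%E \is a fin_num.
Proof.
rewrite ge0_fin_numE; last by apply: nneseries_ge0 => i _ _; exact: dist_term_ge0.
apply: (@le_lt_trans _ _ (1 + 2^-1 ^+ 0)%:E); last exact: ltry.
exact: nabla_dist_series_le.
Qed.

Lemma nabla_dist_le p q (M : nat) (e : R) : 0 <= e ->
  (forall i, (i < M)%N -> `|p i - q i| <= e) ->
  nabla_dist p q <= e + 2^-1 ^+ M.
Proof.
move=> e0 he; rewrite -lee_fin fineK ?nabla_dist_fin//.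
exact: nabla_dist_series_le.
Qed.

Lemma coordinate_dist_le p q i : `|p i - q i| <= 2 ^+ i.+1 * nabla_dist p q.
Proof.
rewrite mulrC -ler_pdivrMr ?exprn_gt0// -lee_fin fineK ?nabla_dist_fin//.
have := @nneseries_lim_ge R (fun k => (`|p k - q k| / 2 ^+ k.+1)%:E)
  xpredT 0 i.+1 (fun k _ _ => dist_term_ge0 p q k).
rewrite big_mkord; apply: le_trans; rewrite sumEFin lee_fin big_ord_recr/=.
by rewrite lerDr sumr_ge0// => k _; rewrite divr_ge0.
Qed.

Lemma ball_nablaE p (r : R) : ball p r = [set q | nabla_dist p q < r].
Proof. by []. Qed.

Lemma ler_dist_add (x y e : R) : `|x - y| < e -> y <= e + x.
Proof. by rewrite ltr_norml => /andP[? ?]; lra. Qed.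

(** A cluster point in the product [0, 1] ^ nat, which is compact, is again
    non-increasing with sum at most 1, these being closed conditions on finitely
    many coordinates. *)
Lemma nabla_cluster (q : nat -> nabla R) : exists p,
  forall (M N : nat) (e : R), 0 < e ->
    exists2 n, (N <= n)%N & forall i, (i < M)%N -> `|q n i - p i| < e.
Proof.
pose A : set {ptws nat -> R} := [set f | forall i, `[0, 1]%classic (f i)].
have cA : compact A.
  by apply: (@tychonoff nat (fun=> R) (fun=> `[0, 1]%classic)) => i;
    exact: segment_compact.
pose f n : {ptws nat -> R} := q n.
have fA : (f @ \oo) A.
  exists 0 => //= n _ i /=.
  by rewrite in_itv/= nabla_ge0/=; exact: nabla_le1.
have [gt [gA gcl]] := cA (f @ \oo) _ fA.
pose g : nat -> R := gt.
have g_near (M N : nat) (e : R) : 0 < e ->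
    exists2 n, (N <= n)%N & forall i, (i < M)%N -> `|q n i - g i| < e.
  move=> e0.
  have h1 : (f @ \oo) [set h | exists2 n, (N <= n)%N & h = f n].
    by exists N => // n /= Nn; exists n.
  have h2 : nbhs gt [set h : {ptws nat -> R} | forall i, (i < M)%N -> `|h i - g i| < e].
    elim: M => [|M IH]; first by apply: filterS filterT => h _ i.
    have h3 : nbhs gt [set h : {ptws nat -> R} | `|h M - g M| < e].
      have := @proj_continuous nat (fun=> R) M gt.
      move=> /(_ [set y | `|y - g M| < e]); apply.
      apply/nbhs_ballP; exists e => //= y; rewrite /ball/= distrC//.
    apply: filterS2 IH h3 => h hM hh i; rewrite ltnS leq_eqVlt => /orP[/eqP->//|].
    exact: hM.
  have [h [[n Nn ->] hn]] := gcl _ _ h1 h2.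
  by exists n.
have g0 i : 0 <= g i by have := gA i; rewrite /= in_itv/= => /andP[].
have gdec i j : (i <= j)%N -> g j <= g i.
  move=> ij; apply/ler_addgt0Pl => e e0.
  have e2 : 0 < e / 2 by rewrite divr_gt0.
  have [n _ hn] := g_near j.+1 0 _ e2.
  have := hn i; rewrite ltnS => /(_ ij); have := hn j (ltnSn _).
  have := nabla_noninc (q n) ij; rewrite !ltr_norml => ? /andP[? ?] /andP[? ?].
  by lra.
have gsum : (\sum_(i <oo) (g i)%:E <= 1)%E.
  apply: lime_le; first by apply: is_cvg_nneseries => i _ _; rewrite lee_fin.
  apply: nearW => M; rewrite big_mkord sumEFin lee_fin.
  apply/ler_addgt0Pl => e e0.
  have e2 : 0 < e / M.+1%:R by rewrite divr_gt0.
  have [n _ hn] := g_near M 0 _ e2.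
  apply: (@le_trans _ _ (\sum_(i < M) (e / M.+1%:R + q n i))).
    by apply: ler_sum => i _; apply: ler_dist_add; exact: hn.
  rewrite big_split/= lerD//.
    rewrite sumr_const card_ord -[leLHS]mulr_natr -mulrA ler_piMr ?(ltW e0)//.
    by rewrite mulrC ler_pdivrMr// mul1r ler_nat.
  exact: le_trans (partial_sum_le _ _) (nabla_sum_le _).
by exists (Nabla gdec g0 gsum).
Qed.

(** Dini's theorem for the increasing sequence of partial sums, which are
    continuous, on the compact set F.  It reduces the upper bound for F to an
    event about the n largest pieces. *)
Lemma closed_partial_sum (F : set (nabla R)) (s : R) : closed F ->
  (forall p, F p -> s < nabla_sum p) ->
  exists n, forall p, F p -> s < \sum_(i < n) p i.
Proof.
move=> clF Fs; apply: contrapT => hno.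
have hq n : exists p, F p /\ \sum_(i < n) p i <= s.
  apply: contrapT => h; apply: hno; exists n => p Fp.
  by rewrite ltNge; apply/negP => hp; apply: h; exists p.
have [q hqF] := choice hq.
have [p hp] := nabla_cluster q.
have Fp : F p.
  apply: clF => B /nbhs_ballP[r /= r0 rB].
  have r2 : 0 < r / 2 by rewrite divr_gt0.
  have h2 : 0 < (2^-1 : R) < 1 by lra.
  have [M hM] := exists_expr_lt h2 r2.
  have [n _ hn] := hp M 0 _ r2.
  exists (q n); split; first by case: (hqF n).
  apply: rB; rewrite ball_nablaE /=.
  apply: (@le_lt_trans _ _ (r / 2 + 2^-1 ^+ M)); last by lra.
  apply: nabla_dist_le => [|i iM]; first exact: ltW.
  by rewrite distrC ltW// hn.
have [M hM] := partial_sum_gt (Fs _ Fp).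
have e0 : 0 < (\sum_(i < M) p i - s) / M.+1%:R by rewrite divr_gt0// subr_gt0.
have [n Mn hn] := hp M M _ e0.
have [_ qs] := hqF n.
have h1 : \sum_(i < M) q n i <= \sum_(i < n) q n i.
  rewrite -!(big_mkord xpredT (fun i => q n i)) (big_cat_nat _ Mn)//=.
  by rewrite lerDl sumr_ge0// => i _; exact: nabla_ge0.
have h2 : \sum_(i < M) p i <= \sum_(i < M) (q n i +
    (\sum_(i < M) p i - s) / M.+1%:R).
  by apply: ler_sum => i _; rewrite addrC; apply: ler_dist_add; exact: hn.
rewrite big_split/= sumr_const card_ord -[X in _ + X]mulr_natr in h2.
have h3 : (\sum_(i < M) p i - s) / M.+1%:R * M%:R < \sum_(i < M) p i - s.
  by rewrite -mulrA gtr_pMr ?subr_gt0// mulrC ltr_pdivrMr// mul1r ltr_nat.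
by move: ((_ / _) * M%:R) h2 h3 => X h2 h3; lra.
Qed.

Lemma pd_rate_gtE p (a : R) : (a%:E < pd_rate p)%E = (1 - expR (- a) < nabla_sum p).
Proof.
rewrite /pd_rate; case: ifPn => [s1|]; last first.
  rewrite -leNgt => s1; have := expR_gt0 (- a); rewrite ltry => h.
  by apply/esym; lra.
have h : 0 < 1 - nabla_sum p by rewrite subr_gt0.
rewrite lte_fin div1r lnV// ltrNr -{1}[- a]expRK ltr_ln ?posrE ?expR_gt0//.
by apply/idP/idP => *; lra.
Qed.

Lemma pd_rate_ge0 p : (0 <= pd_rate p)%E.
Proof.
rewrite /pd_rate; case: ifPn => // s1.
have := partial_sum_le p 0; rewrite big_ord0 => s0.
by rewrite lee_fin ln_ge0// div1r invf_ge1; lra.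
Qed.

(** The total mass is a supremum of partial sums, which are Lipschitz for the
    distance. *)
Lemma lower_semicontinuous_pd_rate : lower_semicontinuous (@pd_rate R).
Proof.
move=> p a; rewrite pd_rate_gtE => /partial_sum_gt[n hn].
set s := 1 - _ in hn.
pose r := (\sum_(i < n) p i - s) / (n%:R * 2 ^+ n + 1).
have n0 : 0 <= n%:R * 2 ^+ n :> R by rewrite mulr_ge0// exprn_ge0.
have n1 : 0 < n%:R * 2 ^+ n + 1 :> R by lra.
have r0 : 0 < r by rewrite divr_gt0// subr_gt0.
exists (ball p r); first exact: nbhsx_ballx.
move=> q; rewrite ball_nablaE /= => pq; rewrite pd_rate_gtE -/s.
apply: lt_le_trans (partial_sum_le q n).
have h : \sum_(i < n) p i <= \sum_(i < n) (q i + 2 ^+ n * r).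
  apply: ler_sum => i _; have := coordinate_dist_le p q i.
  rewrite ler_norml => /andP[_ h].
  have : 2 ^+ i.+1 * nabla_dist p q <= 2 ^+ n * r.
    rewrite ler_pM ?exprn_ge0//; last exact: ltW.
      by apply: fine_ge0; apply: nneseries_ge0 => k _ _; exact: dist_term_ge0.
    by rewrite ler_weXn2l// ler1n.
  lra.
rewrite big_split/= sumr_const card_ord -[X in _ + X]mulr_natr in h.
have : (n%:R * 2 ^+ n + 1) * r = \sum_(i < n) p i - s.
  by rewrite /r mulrC divfK// gt_eqF.
rewrite mulrDl mul1r (_ : n%:R * 2 ^+ n * r = 2 ^+ n * r * n%:R); last by ring.
lra.
Qed.

End nabla_topology.

(** * The exponential lower bound *)

Section lower_bound.
Context {R : realType}.

Lemma independent_adjoin (d : measure_display) (Omega : measurableType d)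
    (P : probability Omega R) (U : nat -> {RV P >-> R}) n k
    (A : nat -> set R) (B : set R) : mutually_independent U -> (n <= k)%N ->
  (forall i, measurable (A i)) -> measurable B ->
  P (\bigcap_(i : 'I_n) (U i @^-1` A i) `&` U k @^-1` B) =
    (P (\bigcap_(i : 'I_n) (U i @^-1` A i)) * P (U k @^-1` B))%E.
Proof.
move=> hU nk mA mB.
pose f (i : 'I_n.+1) : nat := if (i < n)%N then (i : nat) else k.
pose A' (i : 'I_n.+1) : set R := if (i < n)%N then A i else B.
have injf : injective f.
  move=> i j; rewrite /f; have := ltn_ord i; have := ltn_ord j; rewrite !ltnS.
  case: ltnP => hi; case: ltnP => hj leqj leqi e; apply: val_inj => //=.
  - by move: hi; rewrite e ltnNge nk.
  - by move: hj; rewrite -e ltnNge nk.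
  - by apply/eqP; rewrite eqn_leq (leq_trans leqi hj) (leq_trans leqj hi).
have mA' i : measurable (A' i) by rewrite /A'; case: ifP.
have fl (i : 'I_n) : f (widen_ord (leqnSn n) i) = i by rewrite /f /= ltn_ord.
have A'l (i : 'I_n) : A' (widen_ord (leqnSn n) i) = A i by rewrite /A' /= ltn_ord.
have fr : f ord_max = k by rewrite /f /= ltnn.
have A'r : A' ord_max = B by rewrite /A' /= ltnn.
have := independent_injective hU injf mA'.
rewrite big_ord_recr/= fr A'r.
under eq_bigr do rewrite fl A'l.
rewrite -(@independent_injective _ _ _ P U n (@nat_of_ord n) (fun i => A i))//;
  last exact: val_inj.
move=> <-; congr (P _); apply/seteqP; split => w.
  move=> [h1 h2] i _; have [hi|hi] := ltnP i n.
    by have := h1 (Ordinal hi) I; rewrite /= /f /A' hi.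
  by rewrite /= /f /A' ltnNge hi.
move=> h; split => [i _|].
  by have := h (widen_ord (leqnSn n) i) I; rewrite /= fl A'l.
by have := h ord_max I; rewrite /= fr A'r.
Qed.

(** The cylinder A is independent of each single event B k, hence
    P (A and some B k) <= P A * sum b <= P A / 2; independence of infinitely many
    events does not enter. *)
Lemma independent_avoid (d : measure_display) (Omega : measurableType d)
    (P : probability Omega R) (U : nat -> {RV P >-> R}) n
    (A : nat -> set R) (B : nat -> set R) (b : nat -> R) :
  mutually_independent U -> (forall i, measurable (A i)) ->
  (forall k, measurable (B k)) -> (forall k, 0 <= b k) ->
  (forall k, (P (U (n + k)%N @^-1` B k) <= (b k)%:E)%E) ->
  (\sum_(k <oo) (b k)%:E <= (2^-1)%:E)%E ->
  let E := \bigcap_(i : 'I_n) (U i @^-1` A i) `\` \bigcup_k (U (n + k)%N @^-1` B k) in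
  measurable E /\ ((2^-1)%:E * P (\bigcap_(i : 'I_n) (U i @^-1` A i)) <= P E)%E.
Proof.
move=> hU mA mB b0 hb hs E.
set A0 := \bigcap_(i : 'I_n) _ in E *.
have mA0 : measurable A0.
  apply: fin_bigcap_measurable => [|i _]; first exact: finite_finset.
  exact: measurable_funPTI.
have mBk k : measurable (U (n + k)%N @^-1` B k) by exact: measurable_funPTI.
have mBB : measurable (\bigcup_k (U (n + k)%N @^-1` B k)).
  exact: bigcupT_measurable.
have mE : measurable E by exact: measurableD.
split=> //.
pose D := \bigcup_k (A0 `&` U (n + k)%N @^-1` B k).
have mD : measurable D by apply: bigcupT_measurable => k; exact: measurableI.
have Af : P A0 \is a fin_num by exact: fin_num_measure.
have hD : (P D <= P A0 * (2^-1)%:E)%E.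
  apply: (@le_trans _ _ (\sum_(k <oo) P (A0 `&` U (n + k)%N @^-1` B k))%E).
    apply: measure_sigma_subadditive => //.
    by move=> k; exact: measurableI.
  apply: (@le_trans _ _ (\sum_(k <oo) (P A0 * (b k)%:E))%E).
    apply: lee_nneseries => [k _ _|k _]; first exact: measure_ge0.
    rewrite independent_adjoin ?leq_addr//.
    by rewrite lee_wpmul2l// hb.
  rewrite -(fineK Af) nneseriesZl; last by move=> k _; rewrite lee_fin.
  by rewrite lee_wpmul2l// lee_fin fine_ge0.
have Ef : P E \is a fin_num by exact: fin_num_measure.
have hA : (P A0 <= P E + P D)%E.
  apply: le_trans (measureU2 P mE mD).
  apply: le_measure; rewrite ?inE//; first exact: measurableU.
  move=> w Aw; have [[k _ Bk]|nB] := pselect ((\bigcup_k (U (n + k)%N @^-1` B k)) w).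
    by right; exists k.
  by left.
have := le_trans hA (leeD2l _ hD).
rewrite -(fineK Af) -(fineK Ef) -!EFinM -EFinD !lee_fin.
lra.
Qed.

(** The breaks whose pieces are p itself. *)
Definition stick_fraction (p : nabla R) (k : nat) : R :=
  p k / (1 - \sum_(j < k) p j).

Lemma stick_fraction01 (p : nabla R) k : nabla_sum p < 1 ->
  0 <= stick_fraction p k /\ stick_fraction p k <= nabla_sum p.
Proof.
move=> p1.
have h0 := partial_sum_le p k; have h1 := partial_sum_le p k.+1.
rewrite big_ord_recr/= in h1; set S := \sum_(j < k) p j in h0 h1.
have S0 : 0 <= S by rewrite sumr_ge0// => j _; exact: nabla_ge0.
have d0 : 0 < 1 - S by lra.
split; first by rewrite /stick_fraction divr_ge0 ?nabla_ge0 ?(ltW d0).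
rewrite /stick_fraction -/S ler_pdivrMr//.
have : nabla_sum p * S <= S by rewrite ler_piMl// ltW.
by rewrite mulrBr mulr1; lra.
Qed.

Lemma stick_left_fraction (p : nabla R) k : nabla_sum p < 1 ->
  stick_left (stick_fraction p) k = 1 - \sum_(j < k) p j.
Proof.
move=> p1; elim: k => [|k IH].
  by rewrite /stick_left !big_ord0 subr0.
rewrite stick_leftS IH big_ord_recr/= /stick_fraction.
have h0 := partial_sum_le p k.
set S := \sum_(j < k) p j in h0 *.
have d0 : 1 - S != 0 by rewrite gt_eqF; lra.
by field.
Qed.

Lemma stick_breaking_fraction (p : nabla R) k : nabla_sum p < 1 ->
  stick_breaking (stick_fraction p) k = p k.
Proof.
move=> p1; rewrite stick_breakingE !stick_left_fraction// big_ord_recr/=.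
by ring.
Qed.

Lemma stick_breaking_close (u v : nat -> R) (l : R) k :
  (forall i, 0 <= u i <= 1) -> (forall i, 0 <= v i <= 1) ->
  (forall i, (i <= k)%N -> `|u i - v i| <= l) ->
  `|stick_breaking u k - stick_breaking v k| <= k.+1%:R * l.
Proof.
move=> u01 v01 uv.
pose y (x : nat -> R) i := if (i < k)%N then 1 - x i else x i.
have yE (x : nat -> R) : stick_breaking x k = \prod_(i < k.+1) y x i.
  rewrite big_ord_recr/= {2}/y ltnn; congr (_ * _).
  by apply: eq_bigr => i _; rewrite /y ltn_ord.
have y01 (x : nat -> R) i : 0 <= x i <= 1 -> 0 <= y x i <= 1.
  by rewrite /y => /andP[? ?]; case: ifP => _; apply/andP; split; lra.
rewrite !yE (le_trans (dist_prod_le _ _ _))// => [i|i|]; [exact: y01|exact: y01|].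
rewrite (@le_trans _ _ (\sum_(i < k.+1) l))//; last first.
  by rewrite sumr_const card_ord mulr_natl.
apply: ler_sum => i _; have ik : (i <= k)%N by rewrite -ltnS.
rewrite /y; case: ifP => _; last exact: uv.
by rewrite (_ : 1 - u i - (1 - v i) = - (u i - v i)) ?normrN ?uv//; ring.
Qed.

(** Up to index n the pieces are products of close factors; beyond n both
    sequences of pieces lie in [0, g]. *)
Lemma stick_breaking_near (p : nabla R) (v : nat -> R) (g l : R) n :
  nabla_sum p < 1 -> (forall k, 0 <= v k <= 1) -> 0 <= l -> n%:R * l <= g ->
  (forall k, (k < n)%N -> `|v k - stick_fraction p k| <= l) ->
  (forall k, (n <= k)%N -> v k <= g /\ p k <= g) ->
  forall k, `|stick_breaking v k - p k| <= g.
Proof.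
move=> p1 v01 l0 nl vl vg k; have [kn|nk] := ltnP k n.
  rewrite -(stick_breaking_fraction k p1).
  rewrite (le_trans (@stick_breaking_close _ _ l _ _ _ _))//.
  - move=> i; have [-> h] := stick_fraction01 i p1.
    by rewrite (le_trans h)// ltW.
  - by move=> i ik; apply: vl; exact: leq_ltn_trans kn.
  - by rewrite (le_trans _ nl)// ler_wpM2r// ler_nat.
have x0 := stick_breaking_ge0 k v01.
have xv : stick_breaking v k <= v k.
  rewrite /stick_breaking ler_piMl//; first by case/andP: (v01 k).
  exact: (stick_left_le1 k v01).
have [vk pk] := vg _ nk; have := nabla_ge0 p k.
by rewrite ler_norml => ?; apply/andP; split; lra.
Qed.

Lemma nabla_small_tail (p : nabla R) (g : R) : 0 < g ->
  exists n, forall k, (n <= k)%N -> p k <= g.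
Proof.
move=> g0; have [n _ hn] := near_infty_natSinv_lt (PosNum g0).
exists n => k nk; apply: le_trans (nabla_noninc p nk) _.
apply: le_trans (ltW (hn n (leqnn n))); rewrite /= -div1r ler_pdivlMr ?ltr0n//.
apply: le_trans (le_trans (partial_sum_le p n.+1) (nabla_sum_le p)).
rewrite mulr_natr -[X in _ *+ X]card_ord -sumr_const; apply: ler_sum => i _.
by apply: nabla_noninc; rewrite -ltnS.
Qed.

Lemma geometric_series_le (z : R) : 0 <= z < 1 ->
  (\sum_(k <oo) (z ^+ k)%:E <= ((1 - z)^-1)%:E)%E.
Proof.
move=> /andP[z0 z1]; have d0 : 0 < 1 - z by lra.
apply: lime_le.
  by apply: is_cvg_nneseries => i _ _; rewrite lee_fin exprn_ge0.
apply: nearW => m; rewrite big_mkord sumEFin lee_fin -div1r ler_pdivlMr//.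
have -> : (\sum_(k < m) z ^+ k) * (1 - z) = 1 - z ^+ m.
  elim: m => [|m IH]; first by rewrite big_ord0 mul0r expr0 subrr.
  by rewrite big_ord_recr/= mulrDl IH exprS; ring.
by rewrite gerBl exprn_ge0.
Qed.

Lemma prod_powR n (x : 'I_n -> R) (t : R) : (forall i, 0 <= x i) ->
  \prod_i x i `^ t = (\prod_i x i) `^ t.
Proof.
move=> x0; suff [] : 0 <= \prod_i x i /\ \prod_i x i `^ t = (\prod_i x i) `^ t by [].
apply: (big_ind2 (fun y z => 0 <= y /\ z = y `^ t)).
- by rewrite powR1.
- by move=> a b y z [a0 ->] [y0 ->]; rewrite mulr_ge0// powRM.
- by move=> i _; split.
Qed.

Lemma independent_ge (d : measure_display) (Omega : measurableType d)
    (P : probability Omega R) (U : nat -> {RV P >-> R}) n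
    (A : nat -> set R) (c : 'I_n -> R) : mutually_independent U ->
  (forall i, measurable (A i)) -> (forall i, 0 <= c i) ->
  (forall i, ((c i)%:E <= P (U i @^-1` A i))%E) ->
  ((\prod_i c i)%:E <= P (\bigcap_(i : 'I_n) (U i @^-1` A i)))%E.
Proof.
move=> hU mA c0 hc.
rewrite (@independent_injective _ _ _ P U n (@nat_of_ord n) (fun i => A i))//;
  last exact: val_inj.
suff [] : 0 <= \prod_i c i /\
  ((\prod_i c i)%:E <= \prod_(i < n) P (U i @^-1` A i))%E by [].
apply: (big_ind2 (fun x y => 0 <= x /\ (x%:E <= y)%E)).
- by [].
- move=> a b x y [a0 ab] [x0 xy]; split; first exact: mulr_ge0.
  by rewrite EFinM lee_pmul.
- by move=> i _; split.
Qed.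

(** By beta_interval each factor is at least
    (1 - alpha) l (1 - (u i + l)) ^ (theta + n alpha), and the bases multiply to
    at least c. *)
Lemma cylinder_probability (d : measure_display) (Omega : measurableType d)
    (P : probability Omega R) (U : nat -> {RV P >-> R}) (theta alpha : R) n
    (u : nat -> R) (l c : R) : 0 < alpha < 1 -> 1 <= theta ->
  mutually_independent U -> beta_sticks U theta alpha ->
  (forall k, 0 <= u k) -> 0 < l -> (forall k, u k + l < 1) ->
  0 < c <= \prod_(i < n) (1 - (u i + l)) ->
  ((((1 - alpha) * l) ^+ n * c `^ (n%:R * alpha) * c `^ theta)%:E <=
     P (\bigcap_(i : 'I_n) (U i @^-1` `]u i, (u i + l)%R[)))%E.
Proof.
move=> /andP[a0 a1] t1 hU hb u0 l0 ul /andP[c0 cu].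
have a1' : 0 < 1 - alpha < 1 by lra.
have al0 : 0 <= (1 - alpha) * l by case/andP: a1' => h _; rewrite mulr_ge0 ?ltW.
have ul01 k : 0 < 1 - (u k + l) <= 1.
  by have := u0 k; have := ul k; move=> *; apply/andP; split; lra.
pose ci (i : 'I_n) := (1 - alpha) * l * (1 - (u i + l)) `^ (theta + n%:R * alpha).
apply: (@le_trans _ _ (\prod_i ci i)%:E); last first.
  apply: (independent_ge (A := fun i => `]u i, (u i + l)%R[%classic)) => // i.
    by rewrite /ci mulr_ge0 ?powR_ge0.
  have b1 := beta_sticks_gt1 i a0 t1.
  apply: le_trans (beta_interval a1' b1 (hb _) (u0 i) l0 (ul i)).
  rewrite lee_fin ler_wpM2l//; apply: ger_powR => //.
  by rewrite lerD2l ler_wpM2r ?(ltW a0)// ler_nat.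
rewrite lee_fin /ci big_split/= prodr_const card_ord prod_powR; last first.
  by move=> i; have /andP[/ltW] := ul01 i.
rewrite -mulrA ler_wpM2l ?exprn_ge0//.
rewrite -powRD; last by rewrite (gt_eqF c0) implybT.
rewrite addrC; apply: ler_powR_base => //; last exact: ltW.
by rewrite addr_ge0 ?mulr_ge0 ?(ltW a0)// (le_trans ler01).
Qed.

(** By beta_upper_tail the k-th probability is of order rho ^ (theta + k alpha)
    for some rho < 1, so the series is geometric and tends to 0 as theta grows. *)
Lemma late_sticks_small (alpha g : R) : 0 < alpha < 1 -> 0 < g < 1 ->
  \forall theta \near +oo, forall (d : measure_display) (Omega : measurableType d)
    (P : probability Omega R) (U : nat -> {RV P >-> R}) (n : nat),
  beta_sticks U theta alpha ->
  exists b : nat -> R, [/\ forall k, 0 <= b k,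
    forall k, (P (U (n + k)%N @^-1` `[g, +oo[) <= (b k)%:E)%E &
    (\sum_(k <oo) (b k)%:E <= (2^-1)%:E)%E].
Proof.
move=> /andP[a0 a1] /andP[g0 g1].
have g1' : 0 < 1 - g < 1 by lra.
have g2' : 0 < g / 2 < 1 by lra.
have a1' : 0 < 1 - alpha < 1 by lra.
(* eta = g / 2 makes the base y / (1 - eta) of the tail at y = 1 - g less
   than 1. *)
pose rho : R := (1 - g) / (1 - g / 2).
have d0 : 0 < 1 - g / 2 by lra.
have rho0 : 0 < rho by rewrite divr_gt0//; lra.
have rho1 : rho < 1 by rewrite ltr_pdivrMr// mul1r; lra.
pose C : R := g `^ (1 - alpha - 1) / (g / 2).
have C0 : 0 <= C by rewrite divr_ge0 ?powR_ge0//; lra.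
pose z := rho `^ alpha.
have z01 : 0 <= z < 1.
  rewrite powR_ge0/= /z; have := gt0_ltr_powR a0.
  by move=> /(_ rho 1); rewrite powR1 !nnegrE; apply=> //; exact: ltW.
have A0 : 0 <= 2 * C / (1 - z).
  have z1 : 0 <= 1 - z by rewrite subr_ge0; case/andP: z01 => _ /ltW.
  exact: divr_ge0 (mulr_ge0 (ler0n _ 2) C0) z1.
near=> theta => d Omega P U n hb.
have t1 : 1 <= theta by near: theta; apply: nbhs_pinfty_ge; exact: num_real.
exists (fun k => C * rho `^ theta * z ^+ k); split.
- move=> k; case/andP: z01 => z0 _.
  by rewrite mulr_ge0 ?exprn_ge0// mulr_ge0 ?powR_ge0.
- move=> k; have b1 := beta_sticks_gt1 (n + k)%N a0 t1.
  have := beta_upper_tail a1' b1 (hb _) g1' g2'; rewrite subKr => /le_trans; apply.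
  rewrite lee_fin -/C -/rho -[leRHS]mulrA ler_wpM2l//.
  rewrite /z -powR_mulrn ?powR_ge0// -powRrM -powRD; last first.
    by rewrite (gt_eqF rho0) implybT.
  apply: ger_powR; first by rewrite rho0 ltW.
  by rewrite lerD2l mulrC ler_wpM2r ?(ltW a0)// ler_nat -addSn leq_addl.
under eq_eseriesr do rewrite EFinM.
rewrite nneseriesZl; last first.
  by move=> k _; rewrite lee_fin exprn_ge0//; case/andP: z01.
apply: le_trans (lee_wpmul2l _ (geometric_series_le z01)) _.
  by rewrite lee_fin mulr_ge0 ?powR_ge0.
rewrite -EFinM lee_fin.
have : 2 * C / (1 - z) * theta ^+ 0 * rho `^ theta <= 1 `^ theta.
  by near: theta; apply: absorb_polynomial => //; rewrite rho0.
rewrite expr0 mulr1 powR1.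
rewrite (_ : 2 * C / (1 - z) * _ = 2 * (C * rho `^ theta / (1 - z))); last by ring.
by move: (C * _ / _) => x; rewrite -ler_pdivlMl// mulr1.
Unshelve. all: by end_near. Qed.

(** The first n breaks are kept close to those of p, at the exponential cost
    (1 - p 0 - ... - p (n - 1)) ^ theta >= (1 - sum p) ^ theta, and all later
    breaks are kept small, at no exponential cost.  The pieces are then uniformly
    close to p, and sorting them preserves this. *)
Lemma poisson_dirichlet_lower (alpha c : R) (G : set (nabla R)) (p : nabla R) :
  0 < alpha < 1 -> open G -> G p -> 0 < c < 1 - nabla_sum p ->
  \forall theta \near +oo, forall Q : probability (borel (nabla R)) R,
    is_poisson_dirichlet theta alpha Q -> ((c `^ theta)%:E <= Q G)%E.
Proof.
move=> a01 oG Gp /andP[c0 cp]; case/andP: (a01) => a0 a1.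
have p1 : nabla_sum p < 1 by lra.
have /nbhs_ballP[r /= r0 rG] : nbhs p G by exact: open_nbhs_nbhs.
pose g : R := Num.min (r / 4) 2^-1.
have g0 : 0 < g by rewrite lt_min divr_gt0//= invr_gt0.
have gr : g <= r / 4 by rewrite ge_min lexx.
have g1 : g <= 2^-1 by rewrite ge_min lexx orbT.
have [M hM] : exists M : nat, 2^-1 ^+ M < r / 4 :> R.
  by apply: exists_expr_lt; [lra|rewrite divr_gt0].
have gM : g + 2^-1 ^+ M < r by lra.
have [n hn] := nabla_small_tail p g0.
pose e : R := Num.min (1 - nabla_sum p - c) g.
have e0 : 0 < e by rewrite lt_min g0 andbT; lra.
have ec : e <= 1 - nabla_sum p - c by rewrite ge_min lexx.
have eg : e <= g by rewrite ge_min lexx orbT.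
pose l : R := e / 2 / n.+1%:R.
have l0 : 0 < l by rewrite !divr_gt0.
have nl : n.+1%:R * l = e / 2 by rewrite /l mulrC divfK// pnatr_eq0.
have kl k : (k <= n.+1)%N -> k%:R * l <= e / 2.
  by move=> kn; rewrite -nl ler_wpM2r ?(ltW l0)// ler_nat.
have l1 : l <= e / 2 by have := kl 1%N isT; rewrite mul1r.
pose c' : R := 1 - nabla_sum p - e / 2.
have cc' : c < c' by rewrite /c'; lra.
pose u := stick_fraction p.
have u_ge0 k : 0 <= u k by have [] := stick_fraction01 k p1.
have u_le k : u k <= nabla_sum p by have [] := stick_fraction01 k p1.
have ul1 k : u k + l < 1 by have := u_le k; lra.
have ul k : 0 <= 1 - (u k + l) <= 1.
  by rewrite subr_ge0 (ltW (ul1 k))/= gerBl addr_ge0 ?u_ge0 ?(ltW l0).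
have c'_le : c' <= \prod_(i < n) (1 - (u i + l)).
  have u1 k : 0 <= 1 - u k <= 1.
    by rewrite subr_ge0 gerBl u_ge0 (le_trans (u_le k)) ?(ltW p1).
  have := @dist_prod_le _ n (fun k => 1 - (u k + l)) (fun k => 1 - u k) ul u1.
  have -> : \sum_(i < n) `|1 - (u i + l) - (1 - u i)| = n%:R * l.
    transitivity (\sum_(i < n) l); last by rewrite sumr_const card_ord mulr_natl.
    apply: eq_bigr => i _.
    by rewrite (_ : 1 - (u i + l) - (1 - u i) = - l) ?normrN ?gtr0_norm//; ring.
  have : \prod_(i < n) (1 - u i) = 1 - \sum_(j < n) p j.
    exact: stick_left_fraction.
  have := partial_sum_le p n; have := kl n (leqnSn n).
  move=> h1 h2 h3; rewrite ler_norml => /andP[h4 _]; rewrite /c'; lra.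
pose C1 : R := ((1 - alpha) * l) ^+ n * c' `^ (n%:R * alpha).
have C10 : 0 < C1.
  rewrite mulr_gt0 ?powR_gt0 ?exprn_gt0 ?mulr_gt0//; last by lra.
  by lra.
have g01 : 0 < g < 1 by rewrite g0 (le_lt_trans g1)// invf_lt1// ltr1n.
have absorb : \forall theta \near +oo,
    2 / C1 * theta ^+ 0 * c `^ theta <= c' `^ theta.
  by apply: absorb_polynomial; [rewrite c0|rewrite divr_ge0// ltW].
have t_ge1 : \forall theta \near +oo, 1 <= (theta : R).
  by apply: nbhs_pinfty_ge; exact: num_real.
apply: filterS3 (late_sticks_small a01 g01) absorb t_ge1 => theta late absorb t1.
move=> Q [d [T [P [U [V [hU hb hV hQ]]]]]].
pose A i : set R := `]u i, (u i + l)%R[%classic.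
pose B (k : nat) : set R := `[g, +oo[%classic.
have [b [b0 hB hs]] := late d T P U n hb.
have mA i : measurable (A i) by exact: measurable_itv.
have mB k : measurable (B k) by exact: measurable_itv.
have [mE PE] := @independent_avoid _ _ P U n A B b hU mA mB b0 hB hs.
set E := _ `\` _ in mE PE.
have PA : ((C1 * c' `^ theta)%:E <= P (\bigcap_(i : 'I_n) (U i @^-1` A i)))%E.
  apply: cylinder_probability => //.
  by rewrite c'_le andbT (lt_trans c0).
have mG : measurable (G : set (borel (nabla R))) by exact: sub_sigma_algebra.
apply: (@le_trans _ _ (P E)).
  apply: le_trans PE.
  apply: le_trans (lee_wpmul2l _ PA); last by rewrite lee_fin invr_ge0.
  rewrite -EFinM lee_fin.
  move: absorb; rewrite expr0 mulr1 mulrAC ler_pdivrMr// => h.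
  by rewrite ler_pdivlMl// [C1 * _]mulrC.
rewrite hQ//; change (P E <= P (V @^-1` G))%E.
apply: le_measure_ae => //; first exact: measurable_funPTI.
have hU01 : {ae P, forall w, forall k, U k w \in `]0, 1[}.
  apply/ae_foralln => k; exists (U k @^-1` ~` `]0%R, 1%R[); split.
  - by apply: measurable_funPTI; exact: measurableC.
  - exact: (beta_as01 (hb k)).
  - by move=> w /= h h'; apply: h.
apply: filterS2 hU01 hV => w u01 hVw [EA EB].
have u01' k : 0 <= U k w <= 1.
  by have := u01 k; rewrite in_itv/= => /andP[/ltW-> /ltW->].
apply: rG; rewrite ball_nablaE /=.
apply: (@le_lt_trans _ _ (g + 2^-1 ^+ M)) => //.
apply: nabla_dist_le => [|i _]; first exact: ltW.
rewrite distrC; move: i; apply: descending_arrangement_close hVw _.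
  by move=> i j; exact: nabla_noninc.
apply: (@stick_breaking_near _ _ _ l n) => //; first exact: ltW.
- rewrite (le_trans (kl n (leqnSn n)))// (le_trans _ eg)// ler_piMr ?(ltW e0)//.
  by rewrite invf_le1// ler1n.
- move=> k kn; have := EA (Ordinal kn) I.
  rewrite /= /A /= in_itv/= => /andP[h1 h2].
  by rewrite ger0_norm ?subr_ge0 ?lerBlDl ltW.
move=> k nk; split; last exact: hn.
rewrite leNgt; apply/negP => h; apply: EB; exists (k - n)%N => //.
by rewrite /= subnKC// /B /= in_itv/= andbT ltW.
Qed.

End lower_bound.

(** * The large deviation principle *)

Section assembly.
Context {R : realType}.

Lemma limf_esup_le_near (f : R -> \bar R) (y : \bar R) :
  (\forall t \near +oo, (f t <= y)%E) -> (limf_esup f +oo%R <= y)%E.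
Proof.
move=> fy; apply: (@le_trans _ _ (ereal_sup (f @` [set t | (f t <= y)%E]))).
  by apply: ereal_inf_lbound; exists [set t | (f t <= y)%E].
by apply: ge_ereal_sup => _ [t ft <-].
Qed.

Lemma limf_einf_ge_near (f : R -> \bar R) (y : \bar R) :
  (\forall t \near +oo, (y <= f t)%E) -> (y <= limf_einf f +oo%R)%E.
Proof.
move=> fy; rewrite /limf_einf leeNr; apply: limf_esup_le_near.
by apply: filterS fy => t ft; rewrite leeN2.
Qed.

Lemma lee_of_real_below (x y : \bar R) :
  (forall r s : R, r < s -> (s%:E < x)%E -> (r%:E <= y)%E) -> (x <= y)%E.
Proof.
case: x => [x| |]; case: y => [y| |] h //; rewrite ?leey ?leNye//.
- rewrite lee_fin leNgt; apply/negP => yx.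
  have h1 : (2 * x + y) / 3 < (3 * x + y) / 4 by lra.
  have h2 : (((3 * x + y) / 4)%:E < x%:E)%E by rewrite lte_fin; lra.
  by have := h _ _ h1 h2; rewrite lee_fin; lra.
- have h1 : x - 2 < x - 1 by lra.
  have h2 : ((x - 1)%:E < x%:E)%E by rewrite lte_fin; lra.
  by have := h _ _ h1 h2; rewrite leeNy_eq.
- have h1 : y + 1 < y + 2 by lra.
  by have := h _ _ h1 (ltry _); rewrite lee_fin gerDl ler10.
- by have := h _ _ ltr01 (ltry _); rewrite leeNy_eq.
Qed.

Lemma rate_le (c t : R) (x : \bar R) : 0 < c -> 0 < t -> (0 <= x)%E ->
  (x <= (c `^ t)%:E)%E -> (t^-1%:E * lne x <= (ln c)%:E)%E.
Proof.
move=> c0 t0 x0 xc.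
have h : (lne x <= (t * ln c)%:E)%E.
  rewrite -ln_powR -lne_EFin ?powR_gt0// lee_lne//; rewrite in_itv/= ?x0 ?leey//.
  by rewrite lee_fin powR_ge0.
apply: le_trans (lee_wpmul2l _ h) _; first by rewrite lee_fin invr_ge0 ltW.
by rewrite -EFinM mulKf// gt_eqF.
Qed.

Lemma rate_ge (c t : R) (x : \bar R) : 0 < c -> 0 < t -> (0 <= x)%E ->
  ((c `^ t)%:E <= x)%E -> ((ln c)%:E <= t^-1%:E * lne x)%E.
Proof.
move=> c0 t0 x0 xc.
have h : ((t * ln c)%:E <= lne x)%E.
  rewrite -ln_powR -lne_EFin ?powR_gt0// lee_lne//; rewrite in_itv/= ?x0 ?leey//.
  by rewrite lee_fin powR_ge0.
apply: le_trans (lee_wpmul2l _ h); last by rewrite lee_fin invr_ge0 ltW.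
by rewrite -EFinM mulKf// gt_eqF.
Qed.

Lemma measurable_closed_borel (F : set (nabla R)) : closed F ->
  measurable (F : set (borel (nabla R))).
Proof.
move=> clF; rewrite -[F]setCK; apply: measurableC.
by apply: sub_sigma_algebra; exact: closed_openC.
Qed.

End assembly.

Theorem theorem3p4 (R : realType) (alpha : R) (halpha : 0 < alpha < 1)
    (Q : R -> probability (borel (nabla R)) R)
    (hQ : forall theta : R, 0 < theta -> is_poisson_dirichlet theta alpha (Q theta)) :
  large_deviation_principle Q (@pd_rate R).
Proof.
have t_gt0 : \forall t \near +oo, 0 < (t : R).
  by apply: nbhs_pinfty_gt; exact: num_real.
split; [exact: pd_rate_ge0|exact: lower_semicontinuous_pd_rate|move=> F clF|move=> G oG].
- (* The intermediate level s leaves room between exp (- s), the bound that the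
     partial sums give, and exp (- r). *)
  have mF := measurable_closed_borel clF.
  rewrite leeNr; apply: lee_of_real_below => r s rs sI.
  rewrite leeNr; apply: limf_esup_le_near.
  have [r0|r0] := leP r 0.
    apply: filterS t_gt0 => t t0; rewrite -EFinN -[- r]expRK.
    apply: rate_le; rewrite ?expR_gt0//.
    apply: (@le_trans _ _ 1%E); first exact: probability_le1.
    rewrite lee_fin -expRM -expR0 ler_expR mulr_ge0 ?(ltW t0)//; lra.
  have Fs p : F p -> 1 - expR (- s) < nabla_sum p.
    move=> Fp; rewrite -pd_rate_gtE (lt_le_trans sI)//.
    by apply: ereal_inf_lbound; exists p.
  have [n hn] := closed_partial_sum clF Fs.
  have c01 : 0 < 1 - (1 - expR (- s)) < expR (- r).
    by rewrite subKr expR_gt0 ltr_expR ltrN2.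
  have c1 : expR (- r) < 1 by rewrite expR_lt1 oppr_lt0.
  have hup := poisson_dirichlet_upper n halpha c01 c1.
  apply: filterS2 hup t_gt0 => t hup t0; rewrite -EFinN -[- r]expRK.
  by apply: rate_le; rewrite ?expR_gt0// (hup (Q t) (hQ t t0) F).
- have mG : measurable (G : set (borel (nabla R))) by exact: sub_sigma_algebra.
  rewrite leeNl; apply: le_ereal_inf_tmp => _ [p Gp <-].
  rewrite leeNl; apply: lee_of_real_below => r s rs sI.
  have c0 : 0 < expR r < 1 - nabla_sum p.
    rewrite expR_gt0/=; move: sI; rewrite lteNr /pd_rate; case: ifPn => // p1.
    rewrite -EFinN lte_fin div1r lnV ?posrE ?subr_gt0// ltrN2 => sI.
    rewrite -[ltRHS]lnK ?posrE ?subr_gt0// ltr_expR.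
    exact: lt_trans sI.
  apply: limf_einf_ge_near.
  have hlow := poisson_dirichlet_lower halpha oG Gp c0.
  apply: filterS2 hlow t_gt0 => t hlow t0; rewrite -[r]expRK.
  by apply: rate_ge; rewrite ?expR_gt0// (hlow (Q t) (hQ t t0)).
Qed.
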